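(* Let $\tau\in\mathbb{C}\setminus\{0\}$, $\lambda\ge 1$, $0\le\delta\le 1$, and let $\varphi(z)=1+B_1z+B_2z^2+\cdots$ be a function as described in the context. Let $f(z)=z+\sum_{k=2}^{\infty}a_kz^k$ belong to $\mathcal{H}_{\Sigma}(\tau,\lambda,\delta;\varphi)$ and suppose $B_1\ge|B_2|$. Then $$|a_2|\le\begin{cases}\dfrac{B_1\sqrt{B_1}\,|\tau|}{\sqrt{B_1^2|\tau|(1+2\lambda+6\delta)+(B_1+B_2)(1+\lambda+2\delta)^2}} & \text{if } B_2<0,\ B_1+B_2\ge0,\\[3mm] \dfrac{B_1\sqrt{B_1}\,|\tau|}{\sqrt{B_1^2|\tau|(1+2\lambda+6\delta)+(B_1-B_2)(1+\lambda+2\delta)^2}} & \text{if } B_2>0,\ B_1-B_2\ge0,\end{cases}$$ $$|a_3|\le\begin{cases}\dfrac{B_1|\tau|}{1+2\lambda+6\delta} & \text{if } B_1>|B_2|,\\[3mm] \dfrac{|B_2\tau|}{1+2\lambda+6\delta} & \text{if } B_1<|B_2|,\end{cases}$$ and $$|a_3-2a_2^2|\le\begin{cases}\dfrac{B_1|\tau|}{1+2\lambda+6\delta} & \text{if } B_1>|B_2|,\\[3mm] \dfrac{|B_2\tau|}{1+2\lambda+6\delta} & \text{if } B_1<|B_2|.\end{cases}$$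
   Context: $U=\{z\in\mathbb{C}:|z|<1\}$. $\Sigma$ denotes the class of bi-univalent functions in $U$: analytic functions $f(z)=z+\sum_{k\ge2}a_kz^k$ that are univalent in $U$ and whose inverse $g=f^{-1}$ (defined near $0$) is also univalent in $U$, i.e. extends to a univalent analytic function on $U$. For analytic functions $F,G$ on $U$, $F\prec G$ (subordination) means $F=G\circ\omega$ for some analytic $\omega:U\to U$ with $\omega(0)=0$. The function $\varphi$ is analytic in $U$ with positive real part, $\varphi(0)=1$, $\varphi'(0)>0$, $\varphi(U)$ symmetric with respect to the real axis, and expansion $\varphi(z)=1+B_1z+B_2z^2+B_3z^3+\cdots$ with $B_1>0$ and all $B_n\in\mathbb{R}$. For $\lambda\ge1$, $\tau\in\mathbb{C}\setminus\{0\}$, $0\le\delta\le1$, a function $f\in\Sigma$ with inverse $g=f^{-1}$ is in the class $\mathcal{H}_{\Sigma}(\tau,\lambda,\delta;\varphi)$ if, for $z,w\in U$, $$1+\frac1\tau\left((1-\lambda)\frac{f(z)}{z}+\lambda f'(z)+\delta zf''(z)-1\right)\prec\varphi(z)$$ and $$1+\frac1\tau\left((1-\lambda)\frac{g(w)}{w}+\lambda g'(w)+\delta wg''(w)-1\right)\prec\varphi(w).$$ *)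

(* Defs.v *)
From Stdlib Require Import Reals.
From Coquelicot Require Import Coquelicot.
Local Open Scope C_scope.

Definition U (z : C) : Prop := (Cmod z < 1)%R.

(* All functions are total maps [C -> C]; since [U] is open, the notions below
   depend only on their values on [U]. *)

Definition analytic_in_U (f : C -> C) : Prop :=
  forall z0 : C, U z0 ->
  exists (c : nat -> C) (r : R), (0 < r)%R /\
    forall z : C, (Cmod (z - z0) < r)%R -> is_pseries c (z - z0) (f z).

Definition univalent_in_U (f : C -> C) : Prop :=
  analytic_in_U f /\
  forall z1 z2 : C, U z1 -> U z2 -> f z1 = f z2 -> z1 = z2.

Definition expansion_in_U (f : C -> C) (c : nat -> C) : Prop :=
  forall z : C, U z -> is_pseries c z (f z).

Definition normalized_expansion (f : C -> C) (a : nat -> C) : Prop :=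
  a 0%nat = 0 /\ a 1%nat = 1 /\ expansion_in_U f a.

(* [g] coincides near 0 with the inverse of [f] on [U]. *)
Definition local_inverse (f g : C -> C) : Prop :=
  exists r : R, (0 < r)%R /\
    forall w : C, (Cmod w < r)%R -> U (g w) /\ f (g w) = w.

Definition bi_univalent_with_inverse (f g : C -> C) : Prop :=
  univalent_in_U f /\ (exists a : nat -> C, normalized_expansion f a) /\
  univalent_in_U g /\ local_inverse f g.

Definition subordinate (F G : C -> C) : Prop :=
  exists omega : C -> C,
    analytic_in_U omega /\
    (forall z : C, U z -> U (omega z)) /\
    omega 0 = 0 /\
    forall z : C, U z -> F z = G (omega z).

Record admissible_phi (phi : C -> C) (B : nat -> R) : Prop := {
  phi_analytic : analytic_in_U phi;
  phi_Re_pos : forall z : C, U z -> (0 < Re (phi z))%R;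
  phi_0 : phi 0 = 1;
  phi_derive_0 : Im (C_derive phi 0) = 0%R /\ (0 < Re (C_derive phi 0))%R;
  phi_symmetric : forall z : C, U z ->
    exists z' : C, U z' /\ phi z' = Cconj (phi z);
  phi_B0 : B 0%nat = 1%R;
  phi_B1 : (0 < B 1%nat)%R;
  phi_expansion : expansion_in_U phi (fun n => RtoC (B n))
}.

(* [f z / z] with its removable singularity at 0 filled in (for [f 0 = 0]);
   the raw quotient would be 0 there. *)
Definition quot_id (f : C -> C) (z : C) : C :=
  if Ceq_dec z 0 then C_derive f 0 else f z / z.

Definition H_operator (tau : C) (lambda delta : R) (f : C -> C) (z : C) : C :=
  1 + / tau * ((1 - RtoC lambda) * quot_id f z + RtoC lambda * C_derive f z
               + RtoC delta * z * C_derive (C_derive f) z - 1).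

(* The inverse [g] is determined on [U] by [f] (identity theorem), so the
   quantifier over [g] is immaterial. *)
Definition H_Sigma (tau : C) (lambda delta : R) (phi f : C -> C) : Prop :=
  exists g : C -> C,
    bi_univalent_with_inverse f g /\
    subordinate (H_operator tau lambda delta f) phi /\
    subordinate (H_operator tau lambda delta g) phi.

(* Main.v *)
Require Import Defs.
From Stdlib Require Import Reals Lra Lia Classical ClassicalEpsilon.
From Coquelicot Require Import Coquelicot.
Local Open Scope R_scope.

(** Write [M = 1 + lambda + 2 delta] and [N = 1 + 2 lambda + 6 delta]. The operator
    of the class sends [z + a2 z^2 + a3 z^3 + ...] to
    [1 + (M a2 z + N a3 z^2 + ...) / tau], and the inverse [g] has coefficients
    [- a2] and [2 a2^2 - a3]. If [u] and [v] are the Schwarz functions of the two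
    subordinations, comparing coefficients gives
    - [M a2 / tau = B1 u1] and [N a3 / tau = B1 u2 + B2 u1^2],
    - [- M a2 / tau = B1 v1] and [N (2 a2^2 - a3) / tau = B1 v2 + B2 v1^2].
    The Schwarz-Pick inequality [|u2| <= 1 - |u1|^2], and the same for [v], together
    with [|B2| <= B1], bounds the right-hand sides of order 2 by [B1]: these are the
    estimates of [a3] and of [a3 - 2 a2^2] ([coef_bound]). Adding the two equations
    of order 2 eliminates [a3] and keeps a quadratic inequality for [|a2|]
    ([second_coef_bound]).

    The analytic input is the Schwarz-Pick inequality for functions that are only
    known to be locally sums of power series ([schwarz_pick_coef]). It follows from
    two applications of Schwarz's lemma, hence from the maximum principle
    ([max_principle]). The latter is proved without integration: [|F|^2 + eps |z|^2]
    has no interior maximum, because a third order Taylor expansion of [F] allows one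
    to compare a value with its mean over the four points [z0 + s i^k]. So the whole
    argument needs Taylor expansions with remainder O(z^4) only ([jet]). Those
    are unique and stable under sums, products, reciprocals and composition, which
    also makes the comparison of coefficients purely algebraic. Power series enter
    through three facts: they have such expansions, they can be divided by [z], and
    they can be differentiated termwise ([local_pseries_jet], [local_pseries_dquot],
    [local_pseries_derive]). *)

(** * Functions of order O(z^n) at 0 *)

Definition bigO (n : nat) (F : C -> C) : Prop :=
  exists K s : R, 0 < s /\
    forall z : C, Cmod z < s -> Cmod (F z) <= K * Cmod z ^ n.

Lemma bigO_ext_near (n : nat) (F G : C -> C) (s : R) :
  0 < s -> (forall z, Cmod z < s -> F z = G z) -> bigO n F -> bigO n G.
Proof.
  intros Hs HFG (K & t & Ht & HK).
  exists K, (Rmin s t); split; [now apply Rmin_pos|].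
  intros z Hz; rewrite <- HFG.
  - apply HK; apply Rlt_le_trans with (1 := Hz), Rmin_r.
  - apply Rlt_le_trans with (1 := Hz), Rmin_l.
Qed.

Lemma bigO_ext (n : nat) (F G : C -> C) :
  (forall z, F z = G z) -> bigO n F -> bigO n G.
Proof. intros H; apply (bigO_ext_near n F G 1); auto; lra. Qed.

Lemma bigO_plus (n : nat) (F G : C -> C) :
  bigO n F -> bigO n G -> bigO n (fun z => F z + G z)%C.
Proof.
  intros (K & s & Hs & HK) (L & t & Ht & HL).
  exists (K + L), (Rmin s t); split; [now apply Rmin_pos|].
  intros z Hz.
  assert (H1 := HK z (Rlt_le_trans _ _ _ Hz (Rmin_l _ _))).
  assert (H2 := HL z (Rlt_le_trans _ _ _ Hz (Rmin_r _ _))).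
  assert (H3 := Cmod_triangle (F z) (G z)).
  lra.
Qed.

Lemma bigO_mult (m n : nat) (F G : C -> C) :
  bigO m F -> bigO n G -> bigO (m + n) (fun z => F z * G z)%C.
Proof.
  intros (K & s & Hs & HK) (L & t & Ht & HL).
  exists (K * L), (Rmin s t); split; [now apply Rmin_pos|].
  intros z Hz.
  assert (H1 := HK z (Rlt_le_trans _ _ _ Hz (Rmin_l _ _))).
  assert (H2 := HL z (Rlt_le_trans _ _ _ Hz (Rmin_r _ _))).
  rewrite Cmod_mult, pow_add.
  replace (K * L * (Cmod z ^ m * Cmod z ^ n))
    with ((K * Cmod z ^ m) * (L * Cmod z ^ n)) by ring.
  apply Rmult_le_compat; auto using Cmod_ge_0.
Qed.

Lemma bigO_le (m n : nat) (F : C -> C) : (m <= n)%nat -> bigO n F -> bigO m F.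
Proof.
  intros Hmn (K & s & Hs & HK).
  exists (Rmax K 0), (Rmin s 1); split; [apply Rmin_pos; lra|].
  intros z Hz.
  apply Rle_trans with (1 := HK z (Rlt_le_trans _ _ _ Hz (Rmin_l _ _))).
  assert (Hz1 : Cmod z < 1) by exact (Rlt_le_trans _ _ _ Hz (Rmin_r _ _)).
  assert (Hz0 := Cmod_ge_0 z).
  replace n with (m + (n - m))%nat by lia.
  rewrite pow_add.
  assert (0 <= Cmod z ^ m) by now apply pow_le.
  assert (0 <= Cmod z ^ (n - m)) by now apply pow_le.
  assert (Cmod z ^ (n - m) <= 1).
  { rewrite <- (pow1 (n - m)); apply pow_incr; lra. }
  assert (K <= Rmax K 0) by apply Rmax_l.
  assert (0 <= Rmax K 0) by apply Rmax_r.
  apply Rle_trans with (Rmax K 0 * (Cmod z ^ m * Cmod z ^ (n - m))).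
  - apply Rmult_le_compat_r; auto; nra.
  - apply Rmult_le_compat_l; auto; nra.
Qed.

Lemma bigO_const (c : C) : bigO 0 (fun _ => c).
Proof. exists (Cmod c), 1; split; [lra|intros; simpl; lra]. Qed.

Lemma bigO_pow (n : nat) : bigO n (fun z => z ^ n)%C.
Proof. exists 1, 1; split; [lra|intros; rewrite Cmod_pow; lra]. Qed.

Lemma bigO_scal (n : nat) (c : C) (F : C -> C) :
  bigO n F -> bigO n (fun z => c * F z)%C.
Proof. exact (bigO_mult 0 n _ F (bigO_const c)). Qed.

(** * Third order Taylor expansions *)

Definition cubic (a b c d z : C) : C :=
  (a + b * z + c * z ^ 2 + d * z ^ 3)%C.

(** Order 3 serves twice: it gives the third coefficient of an inverse function,
    and it leaves an error O(s^4) that is negligible against the term in [s^2] of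
    [no_interior_max]. Unlike convergence of power series, this relation passes to
    products, quotients and composites by finite algebra. *)
Definition jet (F : C -> C) (a b c d : C) : Prop :=
  bigO 4 (fun z => F z - cubic a b c d z)%C.

Lemma bigO_cubic (a b c d : C) : bigO 0 (cubic a b c d).
Proof.
  unfold cubic.
  repeat apply bigO_plus.
  - apply bigO_const.
  - apply (bigO_le 0 1); [lia|].
    apply bigO_scal. apply (bigO_ext 1 (fun z => z ^ 1)%C); [intro; ring|].
    apply bigO_pow.
  - apply (bigO_le 0 2); [lia|]. apply bigO_scal, bigO_pow.
  - apply (bigO_le 0 3); [lia|]. apply bigO_scal, bigO_pow.
Qed.

Lemma jet_cubic (a b c d : C) : jet (cubic a b c d) a b c d.
Proof.
  exists 0, 1; split; [lra|intros z _].
  replace (cubic a b c d z - cubic a b c d z)%C with (RtoC 0) by ring.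
  rewrite Cmod_0; lra.
Qed.

Lemma jet_bounded (F : C -> C) (a b c d : C) : jet F a b c d -> bigO 0 F.
Proof.
  intros H.
  apply (bigO_ext 0 (fun z => (F z - cubic a b c d z) + cubic a b c d z)%C);
    [intro; ring|].
  apply bigO_plus; [apply (bigO_le 0 4); [lia|exact H]|apply bigO_cubic].
Qed.

Lemma jet_ext_near (F G : C -> C) (s : R) (a b c d : C) :
  0 < s -> (forall z, Cmod z < s -> F z = G z) ->
  jet F a b c d -> jet G a b c d.
Proof.
  intros Hs HFG; apply bigO_ext_near with (s := s); auto.
  intros z Hz; now rewrite HFG.
Qed.

Lemma jet_const (k : C) : jet (fun _ => k) k 0 0 0.
Proof.
  apply (jet_ext_near (cubic k 0 0 0) _ 1); [lra| |apply jet_cubic].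
  intros; unfold cubic; ring.
Qed.

Lemma jet_id : jet (fun z => z) 0 1 0 0.
Proof.
  apply (jet_ext_near (cubic 0 1 0 0) _ 1); [lra| |apply jet_cubic].
  intros; unfold cubic; ring.
Qed.

Lemma jet_plus (F G : C -> C) (a b c d a' b' c' d' : C) :
  jet F a b c d -> jet G a' b' c' d' ->
  jet (fun z => F z + G z)%C (a + a') (b + b') (c + c') (d + d').
Proof.
  intros HF HG; generalize (bigO_plus 4 _ _ HF HG); apply bigO_ext.
  intro z; unfold cubic; ring.
Qed.

(** [F G - P Q = F (G - Q) + (F - P) Q], and the terms of degree at least 4 of
    [P Q] are O(z^4) on their own. *)
Lemma jet_mult (F G : C -> C) (a b c d a' b' c' d' : C) :
  jet F a b c d -> jet G a' b' c' d' ->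
  jet (fun z => F z * G z)%C (a * a') (a * b' + b * a')
    (a * c' + b * b' + c * a') (a * d' + b * c' + c * b' + d * a').
Proof.
  intros HF HG.
  pose (P := cubic a b c d); pose (Q := cubic a' b' c' d').
  assert (H1 := bigO_mult 0 4 _ _ (jet_bounded F _ _ _ _ HF) HG).
  assert (H2 := bigO_mult 4 0 _ _ HF (bigO_cubic a' b' c' d')).
  assert (H3 := bigO_mult 4 0 _ _ (bigO_pow 4)
    (bigO_cubic (b * d' + c * c' + d * b') (c * d' + d * c') (d * d') 0)).
  generalize (bigO_plus 4 _ _ H1 (bigO_plus 4 _ _ H2 H3)); apply bigO_ext.
  intro z; unfold cubic; ring.
Qed.

Lemma jet_scal (k : C) (F : C -> C) (a b c d : C) :
  jet F a b c d -> jet (fun z => k * F z)%C (k * a) (k * b) (k * c) (k * d).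
Proof.
  intros HF; generalize (bigO_scal 4 k _ HF); apply bigO_ext.
  intro z; unfold cubic; ring.
Qed.

(** Dividing by [z ^ k] at the small real point [z = t] gives [|a| <= K t], and
    [t] is arbitrarily small. *)
Lemma monomial_bigO (k : nat) (a : C) :
  bigO (S k) (fun z => a * z ^ k)%C -> a = RtoC 0.
Proof.
  intros (K & s & Hs & HK).
  apply Cmod_eq_0, Rle_antisym; [|apply Cmod_ge_0].
  destruct (Rle_or_lt (Cmod a) 0) as [h|h]; auto.
  (* [t] is chosen so that [K t <= |a| / 2], against [|a| <= K t]. *)
  pose (t := Rmin (s / 2) (Cmod a / (2 * (Rabs K + 1)))).
  assert (HK0 := Rabs_pos K).
  assert (Hq : 0 < Cmod a / (2 * (Rabs K + 1))) by (apply Rdiv_lt_0_compat; lra).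
  assert (Ht : 0 < t) by (apply Rmin_pos; lra).
  assert (Hts : t <= s / 2) by apply Rmin_l.
  assert (Htq : t <= Cmod a / (2 * (Rabs K + 1))) by apply Rmin_r.
  assert (Habs : Cmod t = t) by (rewrite Cmod_R; apply Rabs_pos_eq; lra).
  assert (H1 : Cmod a <= K * t).
  { assert (Hk := HK t); rewrite Cmod_mult, Cmod_pow, Habs in Hk.
    apply Rmult_le_reg_r with (t ^ k); [now apply pow_lt|].
    simpl in Hk; rewrite Rmult_assoc; apply Hk; lra. }
  assert (H2 : (Rabs K + 1) * t <= Cmod a / 2).
  { apply Rmult_le_compat_l with (r := Rabs K + 1) in Htq; [|lra].
    replace ((Rabs K + 1) * (Cmod a / (2 * (Rabs K + 1)))) with (Cmod a / 2)
      in Htq by (field; lra). exact Htq. }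
  assert (H3 := Rle_abs K).
  nra.
Qed.

(** The coefficients are peeled off one at a time: once the lower ones vanish,
    the next monomial is itself of higher order than its degree. *)
Lemma jet_zero (a b c d : C) :
  jet (fun _ => RtoC 0) a b c d ->
  a = RtoC 0 /\ b = RtoC 0 /\ c = RtoC 0 /\ d = RtoC 0.
Proof.
  unfold jet, cubic; intros H.
  assert (Hm : forall k n c, (k <= n)%nat -> bigO k (fun z => c * z ^ n)%C)
    by (intros k n e Hkn; apply (bigO_le k n); auto; apply bigO_scal, bigO_pow).
  assert (Ha : a = RtoC 0).
  { apply (monomial_bigO 0); apply (bigO_le 1) in H; [|lia].
    generalize (bigO_plus _ _ _ (bigO_scal _ (-(1))%C _ H)
      (bigO_plus _ _ _ (Hm 1%nat 1%nat (-b)%C (le_n _))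
        (bigO_plus _ _ _ (Hm 1%nat 2%nat (-c)%C ltac:(lia))
           (Hm 1%nat 3%nat (-d)%C ltac:(lia))))).
    apply bigO_ext; intro; ring. }
  subst a.
  assert (Hb : b = RtoC 0).
  { apply (monomial_bigO 1); apply (bigO_le 2) in H; [|lia].
    generalize (bigO_plus _ _ _ (bigO_scal _ (-(1))%C _ H)
        (bigO_plus _ _ _ (Hm 2%nat 2%nat (-c)%C ltac:(lia))
           (Hm 2%nat 3%nat (-d)%C ltac:(lia)))).
    apply bigO_ext; intro; ring. }
  subst b.
  assert (Hc : c = RtoC 0).
  { apply (monomial_bigO 2); apply (bigO_le 3) in H; [|lia].
    generalize (bigO_plus _ _ _ (bigO_scal _ (-(1))%C _ H)
           (Hm 3%nat 3%nat (-d)%C ltac:(lia))).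
    apply bigO_ext; intro; ring. }
  subst c.
  repeat split; auto.
  apply (monomial_bigO 3).
  generalize (bigO_scal _ (-(1))%C _ H).
  apply bigO_ext; intro; ring.
Qed.

Lemma jet_unique (F : C -> C) (a b c d a' b' c' d' : C) :
  jet F a b c d -> jet F a' b' c' d' -> a = a' /\ b = b' /\ c = c' /\ d = d'.
Proof.
  intros H H'.
  assert (Hd := jet_plus _ _ _ _ _ _ _ _ _ _ H (jet_scal (-(1))%C _ _ _ _ _ H')).
  assert (Hsub : forall x y : C, (x + - (1) * y)%C = RtoC 0 -> x = y).
  { intros x y Hxy; replace x with ((x + - (1) * y) + y)%C by ring.
    rewrite Hxy; ring. }
  destruct (jet_zero (a + - (1) * a') (b + - (1) * b') (c + - (1) * c')
              (d + - (1) * d')) as (Ha & Hb & Hc & Hdd).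
  - revert Hd; apply (jet_ext_near _ _ 1); [lra|]; intros; ring.
  - auto.
Qed.

Lemma bigO_comp (n : nat) (F G : C -> C) :
  bigO n F -> bigO 1 G -> bigO n (fun z => F (G z)).
Proof.
  intros (K & s & Hs & HK) (L & t & Ht & HL).
  pose (L' := Rabs L + 1).
  assert (HL' : L <= L') by (assert (h := Rle_abs L); unfold L'; lra).
  assert (HL0 : 0 < L') by (assert (h := Rabs_pos L); unfold L'; lra).
  exists (Rabs K * L' ^ n), (Rmin t (s / L')).
  split; [apply Rmin_pos; auto; now apply Rdiv_lt_0_compat|].
  intros z Hz.
  assert (HGz := HL z (Rlt_le_trans _ _ _ Hz (Rmin_l _ _))).
  assert (Hz2 := Rlt_le_trans _ _ _ Hz (Rmin_r _ _)).
  assert (Hz0 := Cmod_ge_0 z).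
  assert (HG : Cmod (G z) <= L' * Cmod z) by (simpl in HGz; nra).
  assert (HGs : Cmod (G z) < s).
  { apply Rle_lt_trans with (1 := HG).
    apply Rmult_lt_reg_r with (/ L'); [now apply Rinv_0_lt_compat|].
    replace (L' * Cmod z * / L') with (Cmod z) by (field; lra). exact Hz2. }
  apply Rle_trans with (1 := HK _ HGs).
  rewrite Rmult_assoc, <- Rpow_mult_distr.
  assert (0 <= Cmod (G z) ^ n) by (apply pow_le, Cmod_ge_0).
  assert (Cmod (G z) ^ n <= (L' * Cmod z) ^ n)
    by (apply pow_incr; split; auto; apply Cmod_ge_0).
  assert (HKa := Rle_abs K); assert (HK0 := Rabs_pos K).
  nra.
Qed.

Lemma jet_vanish (G : C -> C) (b c d : C) : jet G 0 b c d -> bigO 1 G.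
Proof.
  intros H; apply (bigO_le 1 4) in H; [|lia].
  assert (Hm : forall n c, (1 <= n)%nat -> bigO 1 (fun z => c * z ^ n)%C)
    by (intros n e Hkn; apply (bigO_le 1 n); auto; apply bigO_scal, bigO_pow).
  generalize (bigO_plus _ _ _ H
      (bigO_plus _ _ _ (Hm 1%nat b (le_n _))
        (bigO_plus _ _ _ (Hm 2%nat c ltac:(lia)) (Hm 3%nat d ltac:(lia))))).
  apply bigO_ext; intro; unfold cubic; ring.
Qed.

(** With [P] the cubic of [F], [F o G - P o G = O(G^4) = O(z^4)] because [G]
    vanishes at 0; then [P o G] is a combination of powers of [G]. *)
Lemma jet_comp (F G : C -> C) (a b c d b' c' d' : C) :
  jet F a b c d -> jet G 0 b' c' d' ->
  jet (fun z => F (G z)) a (b * b') (b * c' + c * b' ^ 2)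
    (b * d' + 2 * c * b' * c' + d * b' ^ 3).
Proof.
  intros HF HG.
  assert (H1 := bigO_comp 4 _ _ HF (jet_vanish _ _ _ _ HG)).
  assert (G2 := jet_mult _ _ _ _ _ _ _ _ _ _ HG HG).
  assert (G3 := jet_mult _ _ _ _ _ _ _ _ _ _ HG G2).
  assert (H2 := jet_plus _ _ _ _ _ _ _ _ _ _ (jet_const a)
    (jet_plus _ _ _ _ _ _ _ _ _ _ (jet_scal b _ _ _ _ _ HG)
      (jet_plus _ _ _ _ _ _ _ _ _ _ (jet_scal c _ _ _ _ _ G2)
         (jet_scal d _ _ _ _ _ G3)))).
  generalize (bigO_plus _ _ _ H1 H2).
  apply bigO_ext; intro z; unfold cubic; ring.
Qed.

Lemma jet_continuous_0 (F : C -> C) (a b c d : C) (eps : R) :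
  jet F a b c d -> 0 < eps ->
  exists s, 0 < s /\ forall z, Cmod z < s -> Cmod (F z - a) < eps.
Proof.
  intros HF Heps.
  assert (H : jet (fun z => F z - a)%C 0 b c d).
  { revert HF; apply bigO_ext; intro; unfold cubic; ring. }
  destruct (jet_vanish _ _ _ _ H) as (K & s & Hs & HK).
  assert (HK0 := Rabs_pos K); assert (HKa := Rle_abs K).
  exists (Rmin s (eps / (Rabs K + 1))).
  split; [apply Rmin_pos; auto; apply Rdiv_lt_0_compat; lra|].
  intros z Hz.
  assert (Hz1 := HK z (Rlt_le_trans _ _ _ Hz (Rmin_l _ _))).
  assert (Hz2 := Rlt_le_trans _ _ _ Hz (Rmin_r _ _)).
  apply Rmult_lt_compat_l with (r := Rabs K + 1) in Hz2; [|lra].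
  replace ((Rabs K + 1) * (eps / (Rabs K + 1))) with eps in Hz2 by (field; lra).
  assert (Hz0 := Cmod_ge_0 z).
  simpl in Hz1; nra.
Qed.

(** Let [E] be the cubic with [F E = 1 + O(z^4)]. Then
    [1/F - E = (1/F) (1 - F E)], where [1/F] is bounded near 0. *)
Lemma jet_inv (F : C -> C) (a b c d : C) :
  a <> RtoC 0 -> jet F a b c d ->
  exists b' c' d', jet (fun z => / F z)%C (/ a) b' c' d'.
Proof.
  intros Ha HF.
  pose (a' := (/ a)%C).
  pose (b' := (- (b * a') / a)%C).
  pose (c' := (- (b * b' + c * a') / a)%C).
  pose (d' := (- (b * c' + c * b' + d * a') / a)%C).
  exists b', c', d'.
  assert (Ham : 0 < Cmod a) by now apply Cmod_gt_0.
  destruct (jet_continuous_0 F a b c d (Cmod a / 2) HF) as (s & Hs & Hnear);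
    [lra|].
  assert (Hlow : forall z, Cmod z < s -> Cmod a / 2 < Cmod (F z)).
  { intros z Hz; specialize (Hnear z Hz).
    assert (h := Cmod_triangle (F z) (-(F z - a))).
    rewrite Cmod_opp in h.
    replace (F z + - (F z - a))%C with a in h by ring. lra. }
  assert (Hne : forall z, Cmod z < s -> F z <> RtoC 0).
  { intros z Hz; apply Cmod_gt_0; specialize (Hlow z Hz); lra. }
  assert (Hinv : bigO 0 (fun z => / F z)%C).
  { exists (/ (Cmod a / 2)), s; split; auto; intros z Hz.
    rewrite Cmod_inv by auto; simpl; rewrite Rmult_1_r.
    apply Rinv_le_contravar; [lra|left; auto]. }
  assert (HFE := jet_mult _ _ _ _ _ _ _ _ _ _ HF (jet_cubic a' b' c' d')).
  assert (H := bigO_mult 0 4 _ _ Hinv (bigO_scal _ (-(1))%C _ HFE)).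
  revert H; apply bigO_ext_near with s; auto.
  intros z Hz; specialize (Hne z Hz).
  unfold cubic, d', c', b', a'; field; auto.
Qed.

Lemma jet_at_0 (F : C -> C) (a b c d : C) : jet F a b c d -> F 0%C = a.
Proof.
  intros (K & s & Hs & HK).
  assert (H := HK (RtoC 0)); rewrite Cmod_0 in H.
  specialize (H Hs); simpl in H.
  replace (F 0%C) with ((F 0 - cubic a b c d 0) + a)%C by (unfold cubic; ring).
  replace (F 0 - cubic a b c d 0)%C with (RtoC 0); [ring|].
  symmetry; apply Cmod_eq_0, Rle_antisym; [lra|apply Cmod_ge_0].
Qed.

(** * Power series at 0 *)

Definition local_pseries (c : nat -> C) (F : C -> C) : Prop :=
  exists r : R, 0 < r /\ forall z : C, Cmod z < r -> is_pseries c z (F z).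

Lemma is_pseries_C (c : nat -> C) (z l : C) :
  is_pseries c z l <->
  is_series (K := C_AbsRing) (V := C_NormedModule) (fun k => c k * z ^ k)%C l.
Proof.
  split; apply is_series_ext; intro n; apply Cmult_comm.
Qed.

Lemma series_Cmod_le (a : nat -> C) (b : nat -> R) (l : C) (S : R) :
  (forall n, Cmod (a n) <= b n) ->
  is_series (K := C_AbsRing) (V := C_NormedModule) a l -> is_series b S ->
  Cmod l <= S.
Proof.
  intros Hab Ha Hb.
  assert (H1 : is_lim_seq (fun n => Cmod (sum_n (G := C_AbelianMonoid) a n)) (Cmod l)).
  { apply (filterlim_comp _ _ _ _ (norm (K := C_AbsRing) (V := C_NormedModule))
      _ _ _ Ha).
    exact (filterlim_norm (K := C_AbsRing) (V := C_NormedModule) l). }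
  assert (H2 : is_lim_seq (sum_n b) S) by exact Hb.
  refine (is_lim_seq_le _ _ _ _ _ H1 H2); intro n.
  apply Rle_trans with
    (1 := norm_sum_n_m (K := C_AbsRing) (V := C_NormedModule) a 0 n).
  apply sum_n_m_le; intro k; apply Hab.
Qed.

Lemma series_terms_bounded (a : nat -> C) (l : C) :
  is_series (K := C_AbsRing) (V := C_NormedModule) a l ->
  exists K, forall n, Cmod (a n) <= K.
Proof.
  intros Ha.
  destruct (filterlim_bounded (K := C_AbsRing) (V := C_NormedModule)
    (sum_n a) (ex_intro _ _ Ha)) as [M HM].
  change (forall n, Cmod (sum_n (G := C_AbelianMonoid) a n) <= M) in HM.
  exists (M + M); intro n.
  destruct n as [|n].
  - specialize (HM 0%nat); rewrite sum_O in HM.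
    assert (h := Cmod_ge_0 (a 0%nat)); lra.
  - assert (Hn := HM n); assert (HSn := HM (S n)).
    rewrite sum_Sn in HSn.
    set (s := sum_n (G := C_AbelianMonoid) a n) in *.
    change (Cmod (s + a (S n)) <= M) in HSn.
    replace (a (S n)) with ((s + a (S n)) + - s)%C by ring.
    apply Rle_trans with (1 := Cmod_triangle _ _).
    rewrite Cmod_opp; now apply Rplus_le_compat.
Qed.

(** A weak form of Cauchy's estimate: the terms of the series at one point of the
    disc of convergence are bounded, because the series converges there. *)
Lemma local_pseries_coef (c : nat -> C) (F : C -> C) :
  local_pseries c F ->
  exists K rho, 0 < rho /\ 0 <= K /\
    (forall n, Cmod (c n) <= K * (/ rho) ^ n) /\
    forall z, Cmod z < rho -> is_pseries c z (F z).
Proof.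
  intros (r & Hr & HF).
  assert (Habs : Cmod (r / 2)%R = r / 2) by (rewrite Cmod_R; apply Rabs_pos_eq; lra).
  assert (H := HF (RtoC (r / 2)%R) ltac:(rewrite Habs; lra)).
  apply is_pseries_C, series_terms_bounded in H.
  destruct H as [K HK].
  exists K, (r / 2); split; [lra|].
  split; [apply Rle_trans with (2 := HK 0%nat), Cmod_ge_0|].
  split.
  - intro n; specialize (HK n); rewrite Cmod_mult, Cmod_pow, Habs in HK.
    rewrite pow_inv.
    assert (0 < (r / 2) ^ n) by (apply pow_lt; lra).
    apply Rmult_le_reg_r with ((r / 2) ^ n); auto.
    rewrite Rmult_assoc, Rinv_l by lra. lra.
  - intros z Hz; apply HF; lra.
Qed.

Lemma is_series_half (L : R) : is_series (fun n => L * (/ 2) ^ n) (L * 2).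
Proof.
  replace (L * 2) with (L * / (1 - / 2)) by field.
  apply (is_series_scal_l L (fun n => (/ 2) ^ n)).
  apply is_series_geom; rewrite Rabs_pos_eq; lra.
Qed.

Lemma local_pseries_bounded (c : nat -> C) (F : C -> C) :
  local_pseries c F -> bigO 0 F.
Proof.
  intros H; destruct (local_pseries_coef _ _ H) as (K & rho & Hrho & HK & Hc & HF).
  exists (K * 2), (rho / 2); split; [lra|]; intros z Hz; simpl; rewrite Rmult_1_r.
  assert (Hzr := HF z ltac:(lra)); apply is_pseries_C in Hzr.
  refine (series_Cmod_le _ _ _ _ _ Hzr (is_series_half K)); intro n.
  rewrite Cmod_mult, Cmod_pow.
  apply Rle_trans with ((K * (/ rho) ^ n) * (rho / 2) ^ n).
  - apply Rmult_le_compat; auto using Cmod_ge_0, pow_le.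
    apply pow_incr; split; [apply Cmod_ge_0|lra].
  - rewrite Rmult_assoc, <- Rpow_mult_distr.
    replace (/ rho * (rho / 2)) with (/ 2) by (field; lra). apply Rle_refl.
Qed.

Lemma pseries_at_0 (c : nat -> C) (l : C) : is_pseries c (RtoC 0) l -> l = c 0%nat.
Proof.
  intro H; apply (filterlim_locally_unique _ _ _ H).
  exact (is_pseries_0 (K := C_AbsRing) (V := C_NormedModule) c).
Qed.

(** The removable singularity at 0 of [(F z - F 0) / z] is filled in with a
    prescribed value, meant to be the derivative of [F] at 0. *)
Definition dquot (F : C -> C) (c1 z : C) : C :=
  if Ceq_dec z 0 then c1 else ((F z - F 0%C) / z)%C.

Lemma dquot_mult (F : C -> C) (c1 z : C) :
  (z * dquot F c1 z = F z - F 0%C)%C.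
Proof.
  unfold dquot; destruct (Ceq_dec z 0) as [->|Hz]; [ring|field; auto].
Qed.

Lemma local_pseries_0 (c : nat -> C) (F : C -> C) :
  local_pseries c F -> F 0%C = c 0%nat.
Proof.
  intros (r & Hr & HF); apply pseries_at_0, HF; rewrite Cmod_0; auto.
Qed.

Lemma local_pseries_dquot (c : nat -> C) (F : C -> C) :
  local_pseries c F -> local_pseries (fun n => c (S n)) (dquot F (c 1%nat)).
Proof.
  intros H; assert (H0 := local_pseries_0 _ _ H).
  destruct H as (r & Hr & HF).
  exists r; split; auto; intros z Hz; unfold dquot.
  destruct (Ceq_dec z 0) as [->|Hz0].
  - exact (is_pseries_0 (K := C_AbsRing) (V := C_NormedModule) (fun n => c (S n))).
  - assert (h := is_pseries_decr_1 c z (/ z)%C (F z) (Cinv_l z Hz0) (HF z Hz)).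
    rewrite H0; replace ((F z - c 0%nat) / z)%C
      with (scal (/ z)%C (plus (F z) (opp (c 0%nat)))); [exact h|].
    change (/ z * (F z + - c 0%nat) = (F z - c 0%nat) / z)%C; field; auto.
Qed.

(** Four successive divided differences give [F z = cubic z + z^4 F4 z], where
    [F4] is again a power series, hence bounded near 0. *)
Lemma local_pseries_jet (c : nat -> C) (F : C -> C) :
  local_pseries c F -> jet F (c 0%nat) (c 1%nat) (c 2%nat) (c 3%nat).
Proof.
  intros H0.
  assert (H1 := local_pseries_dquot _ _ H0).
  assert (H2 := local_pseries_dquot _ _ H1).
  assert (H3 := local_pseries_dquot _ _ H2).
  assert (H4 := local_pseries_dquot _ _ H3).
  assert (E1 := dquot_mult F (c 1%nat)).
  assert (E2 := dquot_mult (dquot F (c 1%nat)) (c 2%nat)).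
  assert (E3 := dquot_mult (dquot (dquot F (c 1%nat)) (c 2%nat)) (c 3%nat)).
  assert (E4 := dquot_mult (dquot (dquot (dquot F (c 1%nat)) (c 2%nat)) (c 3%nat))
    (c 4%nat)).
  set (F1 := dquot F (c 1%nat)) in *.
  set (F2 := dquot F1 (c 2%nat)) in *.
  set (F3 := dquot F2 (c 3%nat)) in *.
  set (F4 := dquot F3 (c 4%nat)) in *.
  rewrite (local_pseries_0 _ _ H0) in E1.
  rewrite (local_pseries_0 _ _ H1) in E2.
  rewrite (local_pseries_0 _ _ H2) in E3.
  rewrite (local_pseries_0 _ _ H3) in E4.
  generalize (bigO_mult 4 0 _ _ (bigO_pow 4) (local_pseries_bounded _ _ H4)).
  apply bigO_ext; intro z; unfold cubic.
  replace (z ^ 4 * F4 z)%C with (z ^ 3 * (z * F4 z))%C by ring; rewrite E4.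
  replace (z ^ 3 * (F3 z - c 3%nat))%C with (z ^ 2 * (z * F3 z) - c 3%nat * z ^ 3)%C
    by ring; rewrite E3.
  replace (z ^ 2 * (F2 z - c 2%nat))%C with (z * (z * F2 z) - c 2%nat * z ^ 2)%C
    by ring; rewrite E2.
  replace (z * (F1 z - c 1%nat))%C with (z * F1 z - c 1%nat * z)%C
    by ring; rewrite E1.
  ring.
Qed.

Definition diff_error (z h : C) (k : nat) : C :=
  ((z + h) ^ k - z ^ k - RtoC (INR k) * z ^ pred k * h)%C.

(** The remainders obey
    [E (k+1) = (z + h) E k + k z^(k-1) h^2], which gives [|E k| <= k^2 rho^(k-2) |h|^2];
    the factor [rho ^ 2] on the left avoids negative exponents. *)
Lemma diff_error_bound (z h : C) (rho : R) (k : nat) :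
  Cmod z <= rho -> Cmod (z + h) <= rho ->
  rho ^ 2 * Cmod (diff_error z h k) <= INR k ^ 2 * rho ^ k * Cmod h ^ 2.
Proof.
  intros Hz Hzh.
  assert (Hz0 := Cmod_ge_0 z); assert (Hh0 := Cmod_ge_0 h).
  induction k as [|k IH].
  - unfold diff_error; simpl.
    replace (1 - 1 - 0 * 1 * h)%C with (RtoC 0) by ring.
    rewrite Cmod_0; lra.
  - assert (E : diff_error z h (S k) =
      ((z + h) * diff_error z h k + RtoC (INR k) * z ^ pred k * h ^ 2)%C).
    { unfold diff_error; rewrite S_INR, RtoC_plus.
      destruct k as [|k]; simpl; ring. }
    rewrite E.
    assert (T := Cmod_triangle ((z + h) * diff_error z h k)
      (RtoC (INR k) * z ^ pred k * h ^ 2)).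
    rewrite !Cmod_mult, !Cmod_pow, Cmod_R, (Rabs_pos_eq (INR k)) in T
      by apply pos_INR.
    assert (Hk := pos_INR k).
    assert (P : INR k * Cmod z ^ pred k * rho ^ 2 <= INR k * rho ^ S k).
    { destruct k as [|k]; [simpl; lra|].
      assert (Cmod z ^ k <= rho ^ k) by (apply pow_incr; lra).
      assert (0 <= rho ^ 2) by (apply pow_le; lra).
      replace (rho ^ S (S k)) with (rho ^ k * rho ^ 2) by (simpl; ring).
      simpl pred. rewrite Rmult_assoc.
      apply Rmult_le_compat_l; auto; apply Rmult_le_compat_r; auto. }
    assert (Q : rho ^ 2 * (Cmod (z + h) * Cmod (diff_error z h k)) <=
      INR k ^ 2 * rho ^ S k * Cmod h ^ 2).
    { apply Rle_trans with (rho * (rho ^ 2 * Cmod (diff_error z h k))).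
      - assert (0 <= rho ^ 2 * Cmod (diff_error z h k))
          by (apply Rmult_le_pos; [apply pow_le; lra|apply Cmod_ge_0]).
        nra.
      - replace (INR k ^ 2 * rho ^ S k * Cmod h ^ 2)
          with (rho * (INR k ^ 2 * rho ^ k * Cmod h ^ 2)) by (simpl; ring).
        apply Rmult_le_compat_l; lra. }
    assert (0 <= Cmod h ^ 2) by (apply pow_le; lra).
    assert (0 <= rho ^ S k) by (apply pow_le; lra).
    rewrite S_INR.
    apply Rle_trans with (rho ^ 2 * (Cmod (z + h) * Cmod (diff_error z h k))
      + INR k * Cmod z ^ pred k * rho ^ 2 * Cmod h ^ 2).
    { assert (0 <= rho ^ 2) by (apply pow_le; lra). nra. }
    apply Rle_trans with (INR k ^ 2 * rho ^ S k * Cmod h ^ 2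
      + INR k * rho ^ S k * Cmod h ^ 2).
    { apply Rplus_le_compat; auto; now apply Rmult_le_compat_r. }
    assert (0 <= rho ^ S k * Cmod h ^ 2) by now apply Rmult_le_pos.
    nra.
Qed.

Lemma INR_S_le_pow2 (n : nat) : INR (S n) <= 2 ^ n.
Proof.
  induction n as [|n IH]; [simpl; lra|].
  rewrite S_INR; simpl pow.
  assert (1 <= 2 ^ n) by (apply pow_R1_Rle; lra). lra.
Qed.

Lemma is_C_derive_quadratic (F : C -> C) (z l : C) (L s : R) :
  0 < s ->
  (forall h, Cmod h < s -> Cmod (F (z + h) - F z - l * h)%C <= L * Cmod h ^ 2) ->
  C_derive F z = l.
Proof.
  intros Hs HF; apply is_C_derive_unique.
  split; [apply is_linear_scal_l|].
  intros x Hx.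
  assert (E : x = z).
  { symmetry; exact (is_filter_lim_locally_unique
      (V := AbsRing_NormedModule C_AbsRing) z x Hx). }
  subst x; intros eps.
  assert (HL := Rabs_pos L); assert (HLa := Rle_abs L).
  assert (Hd : 0 < Rmin s (eps / (Rabs L + 1))).
  { apply Rmin_pos; auto; apply Rdiv_lt_0_compat; [apply cond_pos|lra]. }
  exists (mkposreal _ Hd).
  cut (forall y : C, Cmod (y - z) < Rmin s (eps / (Rabs L + 1)) ->
    Cmod ((F y - F z) - (y - z) * l) <= eps * Cmod (y - z)); [now intro Hy|].
  intros y Hy.
  assert (Hy1 := Rlt_le_trans _ _ _ Hy (Rmin_l _ _)).
  assert (Hy2 := Rlt_le_trans _ _ _ Hy (Rmin_r _ _)).
  assert (H := HF (y - z)%C Hy1).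
  replace (z + (y - z))%C with y in H by ring.
  replace (F y - F z - (y - z) * l)%C with (F y - F z - l * (y - z))%C by ring.
  apply Rle_trans with (1 := H).
  assert (Hm := Cmod_ge_0 (y - z)).
  apply Rmult_lt_compat_l with (r := Rabs L + 1) in Hy2; [|lra].
  replace ((Rabs L + 1) * (eps / (Rabs L + 1))) with (pos eps) in Hy2
    by (field; lra).
  simpl; nra.
Qed.

(** Termwise differentiation, on a disc sixteen times smaller than one on which
    [|c n| <= K / rho^n]. This waste lets the crude bound [(n+1)^2 <= 4^n] absorb the
    polynomial factors, so that everything is dominated by a geometric series of
    ratio 1/2. *)
Lemma local_pseries_derive (c : nat -> C) (F : C -> C) :
  local_pseries c F ->
  local_pseries (fun n => RtoC (INR (S n)) * c (S n))%C (C_derive F).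
Proof.
  intros H; destruct (local_pseries_coef _ _ H) as (K & rho & Hrho & HK & Hc & HF).
  pose (R0 := rho / 16).
  assert (HR0 : 0 < R0) by (unfold R0; lra).
  assert (Hr : 0 < / rho) by now apply Rinv_0_lt_compat.
  exists R0; split; auto; intros z Hz.
  assert (Hconv : ex_series (K := C_AbsRing) (V := C_NormedModule)
    (fun n => RtoC (INR (S n)) * c (S n) * z ^ n)%C).
  { apply (ex_series_le (K := C_AbsRing) (V := C_CompleteNormedModule) _
      (fun n => K * / rho * (/ 2) ^ n)).
    2: exists (K * / rho * 2); apply is_series_half.
    intro n. change (Cmod (RtoC (INR (S n)) * c (S n) * z ^ n)
      <= K * / rho * (/ 2) ^ n).
    rewrite !Cmod_mult, Cmod_pow, Cmod_R, Rabs_pos_eq by apply pos_INR.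
    apply Rle_trans with (2 ^ n * (K * / rho ^ S n) * R0 ^ n).
    - rewrite <- pow_inv.
      apply Rmult_le_compat.
      + apply Rmult_le_pos; [apply pos_INR|apply Cmod_ge_0].
      + apply pow_le, Cmod_ge_0.
      + apply Rmult_le_compat; auto using pos_INR, Cmod_ge_0, INR_S_le_pow2.
      + apply pow_incr; split; [apply Cmod_ge_0|lra].
    - assert (0 <= K * / rho) by (apply Rmult_le_pos; lra).
      replace (2 ^ n * (K * / rho ^ S n) * R0 ^ n)
        with (K * / rho * (/ 8) ^ n).
      + apply Rmult_le_compat_l; auto; apply pow_incr; lra.
      + rewrite <- pow_inv. simpl.
        replace (/ 8) with (2 * / rho * R0) by (unfold R0; field; lra).
        rewrite !Rpow_mult_distr; ring. }
  destruct Hconv as [l Hl].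
  replace (C_derive F z) with l.
  { apply is_pseries_C; exact Hl. }
  symmetry; apply is_C_derive_quadratic with
    (L := K * / R0 ^ 2 * 2) (s := R0 - Cmod z); [lra|].
  intros h Hh.
  assert (Hzh : Cmod (z + h) < R0).
  { apply Rle_lt_trans with (1 := Cmod_triangle z h); lra. }
  assert (Hz' := HF z ltac:(unfold R0 in *; lra)).
  assert (Hzh' := HF (z + h)%C ltac:(unfold R0 in *; lra)).
  apply is_pseries_C in Hz'; apply is_pseries_C in Hzh'.
  assert (HD := is_series_minus _ _ _ _ Hzh' Hz').
  assert (HD' : is_series (K := C_AbsRing) (V := C_NormedModule)
    (fun n => c (S n) * (z + h) ^ S n - c (S n) * z ^ S n)%C (F (z + h) - F z)%C).
  { apply (is_series_incr_1 (K := C_AbsRing) (V := C_NormedModule)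
      (fun n => c n * (z + h) ^ n - c n * z ^ n)%C).
    refine (eq_ind _ (fun v => is_series (K := C_AbsRing) (V := C_NormedModule) _ v)
      HD _ _).
    change (F (z + h) - F z = F (z + h) - F z + (c 0%nat * 1 - c 0%nat * 1))%C; ring. }
  assert (HE := is_series_minus _ _ _ _ HD'
    (is_series_scal (K := C_AbsRing) (V := C_NormedModule) h _ _ Hl)).
  assert (HE' : is_series (K := C_AbsRing) (V := C_NormedModule)
    (fun n => c (S n) * diff_error z h (S n))%C (F (z + h) - F z - l * h)%C).
  { replace (F (z + h) - F z - l * h)%C with (F (z + h) - F z - h * l)%C by ring.
    revert HE; apply is_series_ext; intro n; unfold diff_error.
    change (c (S n) * (z + h) ^ S n - c (S n) * z ^ S n
       - h * (RtoC (INR (S n)) * c (S n) * z ^ n)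
     = c (S n) * ((z + h) ^ S n - z ^ S n - RtoC (INR (S n)) * z ^ n * h))%C.
    ring. }
  replace (K * / R0 ^ 2 * 2 * Cmod h ^ 2) with (K * / R0 ^ 2 * Cmod h ^ 2 * 2) by ring.
  refine (series_Cmod_le _ _ _ _ _ HE' (is_series_half _)); intro n.
  rewrite Cmod_mult.
  assert (HB := diff_error_bound z h R0 (S n) ltac:(lra) ltac:(lra)).
  assert (HR2 : 0 < R0 ^ 2) by now apply pow_lt.
  assert (HB' : Cmod (diff_error z h (S n))
     <= / R0 ^ 2 * ((2 ^ n) ^ 2 * R0 ^ S n * Cmod h ^ 2)).
  { apply Rmult_le_reg_l with (R0 ^ 2); auto.
    rewrite <- Rmult_assoc, Rinv_r, Rmult_1_l by lra.
    apply Rle_trans with (1 := HB).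
    apply Rmult_le_compat_r; [apply pow_le, Cmod_ge_0|].
    apply Rmult_le_compat_r; [apply pow_le; lra|].
    apply pow_incr; split; [apply pos_INR|apply INR_S_le_pow2]. }
  apply Rle_trans with ((K * / rho ^ S n) *
    (/ R0 ^ 2 * ((2 ^ n) ^ 2 * R0 ^ S n * Cmod h ^ 2))).
  { rewrite <- pow_inv; apply Rmult_le_compat; auto using Cmod_ge_0. }
  assert (HRi : 0 < / R0 ^ 2) by now apply Rinv_0_lt_compat.
  assert (0 <= K * / R0 ^ 2 * Cmod h ^ 2).
  { apply Rmult_le_pos; [apply Rmult_le_pos; lra|apply pow_le, Cmod_ge_0]. }
  replace (K * / rho ^ S n * (/ R0 ^ 2 * ((2 ^ n) ^ 2 * R0 ^ S n * Cmod h ^ 2)))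
    with (K * / R0 ^ 2 * Cmod h ^ 2 * (/ 16 * (/ 4) ^ n)).
  - apply Rmult_le_compat_l; auto.
    assert ((/ 4) ^ n <= (/ 2) ^ n) by (apply pow_incr; lra).
    assert (0 <= (/ 4) ^ n) by (apply pow_le; lra). lra.
  - replace (/ 16) with (/ rho * R0) by (unfold R0; field; lra).
    replace (/ 4) with (2 * 2 * (/ rho * R0)) by (unfold R0; field; lra).
    rewrite !Rpow_mult_distr, <- (pow_inv rho). simpl; ring.
Qed.

(** * The maximum principle *)

Definition has_jet (F : C -> C) (z : C) : Prop :=
  exists a b c d : C, jet (fun h => F (z + h)%C) a b c d.

(** Compactness of the closed disc, for a local property that can only improve as
    the radius [d] shrinks. Centres outside the disc get balls that miss it, so that
    compactness of the enclosing square applies. *)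
Lemma disc_uniform (r : R) (P : R -> C -> Prop) :
  (forall d d' w, 0 < d -> d <= d' -> P d' w -> P d w) ->
  (forall z, Cmod z <= r -> exists delta, 0 < delta /\
     forall w, Cmod w <= r -> Cmod (w - z) < delta -> P delta w) ->
  exists d, 0 < d /\ forall w, Cmod w <= r -> P d w.
Proof.
  intros Hanti Hloc.
  assert (Hall : forall z, exists delta : posreal,
    forall w, Cmod w <= r -> Cmod (w - z) < delta -> P delta w).
  { intro z; destruct (Rle_or_lt (Cmod z) r) as [Hz|Hz].
    - destruct (Hloc z Hz) as (delta & Hd & HP).
      now exists (mkposreal delta Hd).
    - assert (Hd : 0 < Cmod z - r) by lra.
      exists (mkposreal _ Hd); simpl; intros w Hw Hwz.
      assert (h := Cmod_triangle w (-(w - z))); rewrite Cmod_opp in h.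
      replace (w + - (w - z))%C with z in h by ring. lra. }
  (* Halved because the square cover controls the two coordinates separately. *)
  pose (delta := fun x y : R => pos_div_2
    (proj1_sig (constructive_indefinite_description _ (Hall (x, y))))).
  destruct (compactness_value_2d (-r) r (-r) r delta) as (d & Hd).
  exists d; split; [apply cond_pos|].
  intros [x y] Hw; apply NNPP; intro HnP.
  assert (Hbox := Rmax_Cmod (x, y)); simpl in Hbox.
  assert (Hx : Rabs x <= r) by (apply Rle_trans with (2 := Hw);
    apply Rle_trans with (2 := Hbox), Rmax_l).
  assert (Hy : Rabs y <= r) by (apply Rle_trans with (2 := Hw);
    apply Rle_trans with (2 := Hbox), Rmax_r).
  apply Rabs_le_between in Hx; apply Rabs_le_between in Hy.
  apply (Hd x y Hx Hy); intros (u & v & _ & _ & Hxu & Hyv & Hdd).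
  apply HnP.
  revert Hxu Hyv Hdd; unfold delta; simpl.
  destruct (constructive_indefinite_description _ (Hall (u, v))) as [e He].
  simpl; intros Hxu Hyv Hdd.
  assert (He0 := cond_pos e).
  apply Hanti with e; [apply cond_pos|lra|].
  apply He; auto.
  replace ((x, y) - (u, v))%C with (RtoC (x - u) + RtoC (y - v) * Ci)%C.
  - apply Rle_lt_trans with (1 := Cmod_triangle _ _).
    rewrite Cmod_mult, Cmod_Ci, !Cmod_R; lra.
  - unfold Cminus, Cplus, Copp, Cmult, Ci, RtoC; simpl; f_equal; ring.
Qed.

(** One use of [disc_uniform] gives an upper bound; if the supremum were not
    attained, a second one would lower it by some [d > 0]. *)
Lemma disc_max (r : R) (u : C -> R) :
  0 <= r ->
  (forall z, Cmod z <= r -> forall eta, 0 < eta -> exists delta, 0 < delta /\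
     forall w, Cmod w <= r -> Cmod (w - z) < delta -> u w < u z + eta) ->
  exists z0, Cmod z0 <= r /\ forall w, Cmod w <= r -> u w <= u z0.
Proof.
  intros Hr Husc.
  destruct (disc_uniform r (fun d w => u w < / d)) as (d0 & Hd0 & Hbound).
  { intros d d' w Hd Hdd Hw; apply Rlt_le_trans with (1 := Hw).
    apply Rinv_le_contravar; auto. }
  { intros z Hz; destruct (Husc z Hz 1 Rlt_0_1) as (delta & Hdelta & Hw).
    assert (Hu : 0 < Rabs (u z) + 1) by (assert (h := Rabs_pos (u z)); lra).
    assert (Hm : 0 < Rmin delta (/ (Rabs (u z) + 1)))
      by (apply Rmin_pos; auto; now apply Rinv_0_lt_compat).
    exists (Rmin delta (/ (Rabs (u z) + 1))); split; auto.
    intros w Hwr Hwz.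
    apply Rlt_le_trans with (u z + 1).
    - apply Hw; auto; apply Rlt_le_trans with (1 := Hwz), Rmin_l.
    - apply Rle_trans with (Rabs (u z) + 1); [assert (h := Rle_abs (u z)); lra|].
      rewrite <- (Rinv_inv (Rabs (u z) + 1)) at 1.
      apply Rinv_le_contravar; auto; apply Rmin_r. }
  destruct (completeness (fun x => exists w, Cmod w <= r /\ x = u w))
    as (S & HS1 & HS2).
  { exists (/ d0); intros x (w & Hw & ->); left; auto. }
  { exists (u 0%C), 0%C; split; auto; rewrite Cmod_0; auto. }
  apply NNPP; intro Hno.
  assert (Hlt : forall z, Cmod z <= r -> u z < S).
  { intros z Hz; destruct (Rle_lt_or_eq_dec (u z) S) as [h|h]; auto.
    - apply HS1; eauto.
    - exfalso; apply Hno; exists z; split; auto.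
      intros w Hw; rewrite h; apply HS1; eauto. }
  destruct (disc_uniform r (fun d w => u w <= S - d)) as (d & Hd & HSd).
  { intros d d' w Hd Hdd Hw; lra. }
  { intros z Hz; specialize (Hlt z Hz).
    destruct (Husc z Hz ((S - u z) / 2)) as (delta & Hdelta & Hw); [lra|].
    exists (Rmin delta ((S - u z) / 2)); split; [apply Rmin_pos; auto; lra|].
    intros w Hwr Hwz.
    assert (h1 := Hw w Hwr (Rlt_le_trans _ _ _ Hwz (Rmin_l _ _))).
    assert (h2 := Rmin_r delta ((S - u z) / 2)). lra. }
  assert (h : S <= S - d); [|lra].
  apply HS2; intros x (w & Hw & ->); auto.
Qed.

Lemma square_near (x eta : R) :
  0 <= x -> 0 < eta ->
  exists t, 0 < t /\ forall y, 0 <= y -> y < x + t -> y ^ 2 < x ^ 2 + eta.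
Proof.
  intros Hx He.
  assert (Hq : 0 < eta / (2 * x + 1)) by (apply Rdiv_lt_0_compat; lra).
  exists (Rmin 1 (eta / (2 * x + 1))); split; [apply Rmin_pos; lra|].
  set (t := Rmin 1 (eta / (2 * x + 1))).
  assert (Ht : 0 < t) by (apply Rmin_pos; lra).
  assert (Ht1 : t <= 1) by apply Rmin_l.
  assert (Ht2 : (2 * x + 1) * t <= eta).
  { replace eta with ((2 * x + 1) * (eta / (2 * x + 1))) by (field; lra).
    apply Rmult_le_compat_l; [lra|apply Rmin_r]. }
  intros y Hy Hyt.
  apply Rlt_le_trans with ((x + t) ^ 2); [nra|].
  nra.
Qed.

Lemma has_jet_continuous (F : C -> C) (z : C) (eps : R) :
  has_jet F z -> 0 < eps ->
  exists s, 0 < s /\ forall w, Cmod (w - z) < s -> Cmod (F w) < Cmod (F z) + eps.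
Proof.
  intros (a & b & c & d & HF) Heps.
  assert (Ha := jet_at_0 _ _ _ _ _ HF); simpl in Ha.
  replace (z + 0)%C with z in Ha by ring.
  destruct (jet_continuous_0 _ _ _ _ _ eps HF Heps) as (s & Hs & HFs).
  exists s; split; auto; intros w Hw.
  specialize (HFs _ Hw).
  replace (z + (w - z))%C with w in HFs by ring.
  assert (h := Cmod_triangle (F w - a) a).
  replace (F w - a + a)%C with (F w) in h by ring.
  rewrite Ha; lra.
Qed.

(** Parseval's identity over the four fourth roots of unity; it is exact because
    the degree is less than 4. *)
Lemma parseval4 (a b c d : C) (s : R) :
  Cmod (cubic a b c d (RtoC s)) ^ 2 + Cmod (cubic a b c d (RtoC (- s))) ^ 2
  + Cmod (cubic a b c d (RtoC s * Ci)) ^ 2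
  + Cmod (cubic a b c d (RtoC (- s) * Ci)) ^ 2
  = 4 * (Cmod a ^ 2 + Cmod b ^ 2 * s ^ 2 + Cmod c ^ 2 * s ^ 4
         + Cmod d ^ 2 * s ^ 6).
Proof.
  rewrite !Cmod2_alt.
  destruct a as [a1 a2], b as [b1 b2], c as [c1 c2], d as [d1 d2].
  unfold cubic, Re, Im, Cplus, Cmult, RtoC, Ci; simpl; ring.
Qed.

Lemma Cmod2_mean4 (z : C) (s : R) :
  Cmod (z + RtoC s) ^ 2 + Cmod (z + RtoC (- s)) ^ 2
  + Cmod (z + RtoC s * Ci) ^ 2 + Cmod (z + RtoC (- s) * Ci) ^ 2
  = 4 * Cmod z ^ 2 + 4 * s ^ 2.
Proof.
  rewrite !Cmod2_alt; destruct z as [x y].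
  unfold Re, Im, Cplus, Cmult, RtoC, Ci; simpl; ring.
Qed.

(** The mean of [|F|^2] over the four points [z0 + s i^k] is at least [|F z0|^2]
    up to O(s^4), by [parseval4], while the mean of [eps |z|^2] exceeds its value at
    [z0] by exactly [eps s^2]. For small [s] the second effect wins. The
    term in [eps] makes the function strictly subharmonic, which also covers an [F]
    that is constant near [z0]. *)
Lemma no_interior_max (F : C -> C) (z0 : C) (eps t : R) :
  has_jet F z0 -> 0 < eps -> 0 < t ->
  exists w, Cmod (w - z0) < t /\
    Cmod (F z0) ^ 2 + eps * Cmod z0 ^ 2 < Cmod (F w) ^ 2 + eps * Cmod w ^ 2.
Proof.
  intros (a & b & c & d & HF) Heps Ht.
  assert (Ha := jet_at_0 _ _ _ _ _ HF); simpl in Ha.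
  replace (z0 + 0)%C with z0 in Ha by ring.
  destruct HF as (K & s1 & Hs1 & HK).
  destruct (bigO_cubic a b c d) as (L & s2 & Hs2 & HL).
  apply NNPP; intro Hno.
  assert (Hmax : forall w, Cmod (w - z0) < t ->
    Cmod (F w) ^ 2 + eps * Cmod w ^ 2 <= Cmod (F z0) ^ 2 + eps * Cmod z0 ^ 2).
  { intros w Hw; destruct (Rle_or_lt (Cmod (F w) ^ 2 + eps * Cmod w ^ 2)
      (Cmod (F z0) ^ 2 + eps * Cmod z0 ^ 2)); auto.
    exfalso; apply Hno; eauto. }
  assert (HL0 : 0 <= L).
  { assert (h := HL (RtoC 0)); rewrite Cmod_0 in h; specialize (h Hs2).
    assert (h' := Cmod_ge_0 (cubic a b c d 0)); simpl in h; lra. }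
  assert (HKa := Rle_abs K); assert (HK0 := Rabs_pos K).
  set (A := L * Rabs K) in *.
  assert (HA : 0 <= A) by now apply Rmult_le_pos.
  pose (s := Rmin (Rmin s1 s2 / 2) (Rmin (t / 2) (Rmin 1 (eps / (4 * (A + 1)))))).
  assert (Hq : 0 < eps / (4 * (A + 1))) by (apply Rdiv_lt_0_compat; lra).
  assert (Hm12 : 0 < Rmin s1 s2) by now apply Rmin_pos.
  assert (Hs : 0 < s).
  { unfold s; repeat apply Rmin_pos; lra. }
  assert (Hs_12 : s < s1 /\ s < s2).
  { assert (h1 := Rmin_l s1 s2); assert (h2 := Rmin_r s1 s2).
    assert (h : s <= Rmin s1 s2 / 2) by apply Rmin_l. split; lra. }
  assert (Hs_t : s < t).
  { assert (h : s <= t / 2) by (eapply Rle_trans; [apply Rmin_r|apply Rmin_l]).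
    lra. }
  assert (Hs_1 : s <= 1 /\ s <= eps / (4 * (A + 1))).
  { assert (h : s <= Rmin 1 (eps / (4 * (A + 1))))
      by (eapply Rle_trans; [apply Rmin_r|apply Rmin_r]).
    split; eapply Rle_trans; try apply h; [apply Rmin_l|apply Rmin_r]. }
  assert (Hs_e : (A + 1) * s <= eps / 4).
  { replace (eps / 4) with ((A + 1) * (eps / (4 * (A + 1)))) by (field; lra).
    apply Rmult_le_compat_l; lra. }
  (* Maximality at [z0], rewritten for the cubic in place of [F]: the error is
     [|P|^2 - |F|^2 <= 2 |P| |F - P| <= 2 L K s^4]. *)
  assert (Hpt : forall h, Cmod h = s ->
    Cmod (cubic a b c d h) ^ 2 + eps * Cmod (z0 + h) ^ 2 <=
    Cmod (F z0) ^ 2 + eps * Cmod z0 ^ 2 + 2 * A * s ^ 4).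
  { intros h Hh.
    assert (h1 := Hmax (z0 + h)%C).
    replace (z0 + h - z0)%C with h in h1 by ring.
    specialize (h1 ltac:(lra)).
    assert (h2 := HK h ltac:(lra)); assert (h3 := HL h ltac:(lra)).
    simpl in h3; rewrite Rmult_1_r in h3.
    assert (h4 := Cmod_triangle (F (z0 + h)%C)
                    (- (F (z0 + h)%C - cubic a b c d h))).
    rewrite Cmod_opp in h4.
    replace (F (z0 + h) + - (F (z0 + h) - cubic a b c d h))%C
      with (cubic a b c d h) in h4 by ring.
    set (p := Cmod (cubic a b c d h)) in *.
    set (e := Cmod (F (z0 + h)%C - cubic a b c d h)) in *.
    assert (Hp0 : 0 <= p) by apply Cmod_ge_0.
    assert (He0 : 0 <= e) by apply Cmod_ge_0.
    assert (HF0 : 0 <= Cmod (F (z0 + h)%C)) by apply Cmod_ge_0.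
    assert (Hpe : p ^ 2 <= Cmod (F (z0 + h)%C) ^ 2 + 2 * p * e).
    { destruct (Rle_or_lt p e); nra. }
    assert (Hs4 : 0 <= s ^ 4) by (apply pow_le; lra).
    assert (Hpe' : p * e <= A * s ^ 4).
    { unfold A; rewrite Rmult_assoc; apply Rmult_le_compat; auto.
      rewrite Hh in h2. nra. }
    nra. }
  assert (Hs_abs : Cmod (RtoC s) = s) by (rewrite Cmod_R; apply Rabs_pos_eq; lra).
  assert (Hs_abs' : Cmod (RtoC (- s)) = s)
    by (rewrite Cmod_R, Rabs_Ropp; apply Rabs_pos_eq; lra).
  assert (p1 := Hpt (RtoC s) Hs_abs).
  assert (p2 := Hpt (RtoC (- s)) Hs_abs').
  assert (p3 := Hpt (RtoC s * Ci)%C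
    ltac:(rewrite Cmod_mult, Cmod_Ci; lra)).
  assert (p4 := Hpt (RtoC (- s) * Ci)%C
    ltac:(rewrite Cmod_mult, Cmod_Ci; lra)).
  assert (P := parseval4 a b c d s).
  assert (Q := Cmod2_mean4 z0 s).
  assert (Hb : 0 <= Cmod b ^ 2 * s ^ 2 + Cmod c ^ 2 * s ^ 4 + Cmod d ^ 2 * s ^ 6).
  { repeat apply Rplus_le_le_0_compat; apply Rmult_le_pos; apply pow_le;
      auto using Cmod_ge_0; lra. }
  rewrite Ha in *.
  assert (G : eps * s ^ 2 <= 2 * A * s ^ 4) by nra.
  assert (G' : eps <= 2 * A * s ^ 2).
  { apply Rmult_le_reg_r with (s ^ 2); [now apply pow_lt|].
    replace (2 * A * s ^ 2 * s ^ 2) with (2 * A * s ^ 4) by ring; exact G. }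
  assert (s ^ 2 <= s) by nra.
  nra.
Qed.

(** The maximum of [|F|^2 + eps |z|^2] on the disc lies on the circle, by
    [no_interior_max]; then [eps] tends to 0. *)
Lemma max_principle (F : C -> C) (r M : R) :
  0 <= r ->
  (forall z, Cmod z <= r -> has_jet F z) ->
  (forall z, Cmod z = r -> Cmod (F z) <= M) ->
  forall z, Cmod z <= r -> Cmod (F z) <= M.
Proof.
  intros Hr Hjet HM z Hz.
  assert (HM0 : 0 <= M).
  { apply Rle_trans with (2 := HM (RtoC r)
      ltac:(rewrite Cmod_R; now apply Rabs_pos_eq)), Cmod_ge_0. }
  assert (Heps : forall eps, 0 < eps -> Cmod (F z) ^ 2 <= M ^ 2 + eps * r ^ 2).
  { intros eps Heps.
    destruct (disc_max r (fun w => Cmod (F w) ^ 2 + eps * Cmod w ^ 2) Hr)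
      as (z0 & Hz0 & Hmax).
    { intros w Hw eta Heta.
      destruct (square_near (Cmod (F w)) (eta / 2)) as (t1 & Ht1 & Hsq1);
        [apply Cmod_ge_0|lra|].
      destruct (square_near (Cmod w) (eta / (2 * eps))) as (t2 & Ht2 & Hsq2);
        [apply Cmod_ge_0|apply Rdiv_lt_0_compat; lra|].
      destruct (has_jet_continuous F w t1 (Hjet w Hw) Ht1) as (s & Hs & HFs).
      exists (Rmin s t2); split; [now apply Rmin_pos|].
      intros v Hv Hvw.
      assert (h1 := Hsq1 _ (Cmod_ge_0 (F v))
        (HFs v (Rlt_le_trans _ _ _ Hvw (Rmin_l _ _)))).
      assert (h2 : Cmod v ^ 2 < Cmod w ^ 2 + eta / (2 * eps)).
      { apply Hsq2; [apply Cmod_ge_0|].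
        assert (h := Cmod_triangle w (v - w)).
        replace (w + (v - w))%C with v in h by ring.
        assert (h' := Rlt_le_trans _ _ _ Hvw (Rmin_r _ _)); lra. }
      apply Rmult_lt_compat_l with (r := eps) in h2; auto.
      replace (eps * (Cmod w ^ 2 + eta / (2 * eps)))
        with (eps * Cmod w ^ 2 + eta / 2) in h2 by (field; lra).
      lra. }
    assert (Hb : Cmod z0 = r).
    { destruct (Rle_lt_or_eq_dec _ _ Hz0) as [h|h]; auto; exfalso.
      destruct (no_interior_max F z0 eps (r - Cmod z0) (Hjet z0 Hz0) Heps)
        as (w & Hw & Hbig); [lra|].
      assert (hw := Cmod_triangle z0 (w - z0)).
      replace (z0 + (w - z0))%C with w in hw by ring.
      specialize (Hmax w ltac:(lra)). lra. }
    specialize (Hmax z Hz).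
    assert (h1 := HM z0 Hb); assert (h0 := Cmod_ge_0 (F z0)).
    rewrite Hb in Hmax.
    assert (0 <= eps * Cmod z ^ 2)
      by (apply Rmult_le_pos; [lra|apply pow_le, Cmod_ge_0]).
    nra. }
  assert (H2 : Cmod (F z) ^ 2 <= M ^ 2).
  { apply le_epsilon; intros e He.
    assert (Hr2 : 0 < r ^ 2 + 1) by nra.
    apply Rle_trans with (1 := Heps (e / (r ^ 2 + 1)) ltac:(now apply Rdiv_lt_0_compat)).
    apply Rplus_le_compat_l.
    apply Rmult_le_reg_r with (r ^ 2 + 1); auto.
    replace (e / (r ^ 2 + 1) * r ^ 2 * (r ^ 2 + 1)) with (e * r ^ 2) by (field; lra).
    nra. }
  assert (h0 := Cmod_ge_0 (F z)).
  nra.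
Qed.

(** * Schwarz's lemma and the Schwarz-Pick inequality for coefficients *)

Lemma has_jet_const (k z : C) : has_jet (fun _ => k) z.
Proof. do 4 eexists; apply (jet_const k). Qed.

Lemma has_jet_plus (F G : C -> C) (z : C) :
  has_jet F z -> has_jet G z -> has_jet (fun w => F w + G w)%C z.
Proof.
  intros (a & b & c & d & H) (a' & b' & c' & d' & H').
  do 4 eexists; exact (jet_plus _ _ _ _ _ _ _ _ _ _ H H').
Qed.

Lemma has_jet_mult (F G : C -> C) (z : C) :
  has_jet F z -> has_jet G z -> has_jet (fun w => F w * G w)%C z.
Proof.
  intros (a & b & c & d & H) (a' & b' & c' & d' & H').
  do 4 eexists; exact (jet_mult _ _ _ _ _ _ _ _ _ _ H H').
Qed.

Lemma has_jet_inv (F : C -> C) (z : C) :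
  F z <> RtoC 0 -> has_jet F z -> has_jet (fun w => / F w)%C z.
Proof.
  intros Hne (a & b & c & d & H).
  assert (Ha := jet_at_0 _ _ _ _ _ H); simpl in Ha.
  replace (z + 0)%C with z in Ha by ring; rewrite Ha in Hne.
  destruct (jet_inv _ _ _ _ _ Hne H) as (b' & c' & d' & H').
  do 4 eexists; exact H'.
Qed.

Lemma has_jet_id (z : C) : has_jet (fun w => w) z.
Proof.
  do 4 eexists; exact (jet_plus _ _ _ _ _ _ _ _ _ _ (jet_const z) jet_id).
Qed.

Lemma has_jet_ext_near (F G : C -> C) (z : C) (s : R) :
  0 < s -> (forall w, Cmod (w - z) < s -> F w = G w) ->
  has_jet F z -> has_jet G z.
Proof.
  intros Hs HFG (a & b & c & d & H).
  exists a, b, c, d; refine (jet_ext_near _ _ s _ _ _ _ Hs _ H).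
  intros h Hh; apply HFG; now replace (z + h - z)%C with h by ring.
Qed.

Lemma has_jet_dquot (F : C -> C) (c1 z : C) :
  z <> RtoC 0 -> has_jet F z -> has_jet (dquot F c1) z.
Proof.
  intros Hz H.
  apply has_jet_ext_near with (fun w => (F w + - F 0) * / w)%C (Cmod z).
  - now apply Cmod_gt_0.
  - intros w Hw; unfold dquot; destruct (Ceq_dec w 0) as [->|Hw0]; [|reflexivity].
    exfalso; replace (0 - z)%C with (- z)%C in Hw by ring.
    rewrite Cmod_opp in Hw; lra.
  - apply has_jet_mult.
    + apply has_jet_plus; auto; apply has_jet_const.
    + apply has_jet_inv; auto; apply has_jet_id.
Qed.

Lemma local_pseries_has_jet (c : nat -> C) (F : C -> C) :
  local_pseries c F -> has_jet F 0%C.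
Proof.
  intros H; do 4 eexists.
  refine (jet_ext_near _ _ 1 _ _ _ _ Rlt_0_1 _ (local_pseries_jet _ _ H)).
  intros z _; f_equal; ring.
Qed.

Lemma analytic_local_pseries (F : C -> C) :
  analytic_in_U F -> exists c, local_pseries c F.
Proof.
  intros HF; destruct (HF (RtoC 0)) as (c & r & Hr & H).
  { unfold U; rewrite Cmod_0; lra. }
  exists c, r; split; auto; intros z Hz.
  replace z with (z - 0)%C at 1 by ring; apply H.
  now replace (z - 0)%C with z by ring.
Qed.

Lemma analytic_has_jet (F : C -> C) (z : C) :
  analytic_in_U F -> U z -> has_jet F z.
Proof.
  intros HF Hz; destruct (HF z Hz) as (c & r & Hr & H).
  do 4 eexists; apply (local_pseries_jet c).
  exists r; split; auto; intros h Hh.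
  replace h with (z + h - z)%C at 1 by ring; apply H.
  now replace (z + h - z)%C with h by ring.
Qed.

Lemma le_1_of_scaled (m x : R) :
  m < 1 -> (forall r, m < r < 1 -> 0 < r -> r * x <= 1) -> x <= 1.
Proof.
  intros Hm H; destruct (Rle_or_lt x 1) as [h|h]; auto.
  assert (Hi : 0 < / x < 1).
  { split; [apply Rinv_0_lt_compat; lra|].
    rewrite <- Rinv_1; apply Rinv_lt_contravar; lra. }
  pose (r := (Rmax m (/ x) + 1) / 2).
  assert (H1 := Rmax_l m (/ x)); assert (H2 := Rmax_r m (/ x)).
  assert (H3 : Rmax m (/ x) < 1) by now apply Rmax_lub_lt.
  specialize (H r ltac:(unfold r; lra) ltac:(unfold r; lra)).
  assert (H4 : / x < r) by (unfold r; lra).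
  apply Rmult_lt_compat_r with (r := x) in H4; [|lra].
  rewrite Rinv_l in H4 by lra. lra.
Qed.

(** Schwarz's lemma in the form in which it is iterated. On the circle of radius
    [r] one has [|G| <= 1/r]; the maximum principle carries this inside, and [r]
    tends to 1. *)
Lemma schwarz_factor (G : C -> C) :
  (forall z, U z -> has_jet G z) ->
  (forall z, U z -> Cmod (z * G z) <= 1) ->
  forall z, U z -> Cmod (G z) <= 1.
Proof.
  intros HG Hb z Hz.
  apply (le_1_of_scaled (Cmod z)); [exact Hz|].
  intros r [Hr1 Hr2] Hr0.
  assert (H : Cmod (G z) <= / r).
  { apply (max_principle G r); [lra| | |lra].
    - intros w Hw; apply HG; unfold U; lra.
    - intros w Hw; assert (h := Hb w ltac:(unfold U; lra)).
      rewrite Cmod_mult, Hw in h.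
      apply Rmult_le_reg_l with r; auto; rewrite Rinv_r; lra. }
  apply Rmult_le_compat_l with (r := r) in H; [|lra].
  rewrite Rinv_r in H; lra.
Qed.

(** [|1 - conj(a) b|^2 - |b - a|^2 = (1 - |a|^2) (1 - |b|^2)]. *)
Lemma moebius_le (a b : C) :
  Cmod a <= 1 -> Cmod b <= 1 -> Cmod (b - a) <= Cmod (1 - Cconj a * b).
Proof.
  intros Ha Hb.
  assert (E : Cmod (1 - Cconj a * b) ^ 2 - Cmod (b - a) ^ 2 =
    (1 - Cmod a ^ 2) * (1 - Cmod b ^ 2)).
  { rewrite !Cmod2_alt; destruct a as [a1 a2], b as [b1 b2].
    unfold Cconj, Re, Im, Cminus, Cplus, Copp, Cmult, RtoC; simpl; ring. }
  assert (h1 := Cmod_ge_0 a); assert (h2 := Cmod_ge_0 b).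
  assert (h3 := Cmod_ge_0 (b - a)); assert (h4 := Cmod_ge_0 (1 - Cconj a * b)).
  assert (0 <= (1 - Cmod a ^ 2) * (1 - Cmod b ^ 2)) by (apply Rmult_le_pos; nra).
  nra.
Qed.

(** By Schwarz, [h = omega / z] satisfies [|h| <= 1] and has [h 0 = c1]. For
    [r < 1], the Moebius quotient [(r h - r c1) / (1 - conj(r c1) r h)] is bounded
    by 1 and vanishes at 0, so Schwarz applies again and bounds its derivative
    there: [r |c2| <= 1 - r^2 |c1|^2]. Scaling by [r] keeps the denominator away
    from 0 even when [|c1| = 1]. *)
Lemma schwarz_pick_coef (omega : C -> C) (c : nat -> C) :
  analytic_in_U omega -> (forall z, U z -> U (omega z)) -> omega 0%C = 0%C ->
  local_pseries c omega ->
  Cmod (c 1%nat) <= 1 /\ Cmod (c 2%nat) <= 1 - Cmod (c 1%nat) ^ 2.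
Proof.
  intros Han HU H0 Hc.
  pose (h := dquot omega (c 1%nat)).
  assert (U0 : U 0%C) by (unfold U; rewrite Cmod_0; lra).
  assert (Hch : local_pseries (fun n => c (S n)) h)
    by exact (local_pseries_dquot _ _ Hc).
  assert (Hh0 : h 0%C = c 1%nat) by exact (local_pseries_0 _ _ Hch).
  assert (Hh_jet : forall z, U z -> has_jet h z).
  { intros z Hz; destruct (Ceq_dec z 0) as [->|Hz0].
    - exact (local_pseries_has_jet _ _ Hch).
    - apply has_jet_dquot; auto; now apply analytic_has_jet. }
  assert (Hh1 : forall z, U z -> Cmod (h z) <= 1).
  { apply schwarz_factor; auto; intros z Hz; unfold h.
    rewrite dquot_mult, H0; replace (omega z - 0)%C with (omega z) by ring.
    left; now apply HU. }
  assert (Hc1 : Cmod (c 1%nat) <= 1) by (rewrite <- Hh0; auto).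
  split; auto.
  pose (k := dquot h (c 2%nat)).
  assert (Hck : local_pseries (fun n => c (S (S n))) k)
    by exact (local_pseries_dquot _ _ Hch).
  assert (Hk0 : k 0%C = c 2%nat) by exact (local_pseries_0 _ _ Hck).
  assert (Hk_jet : forall z, U z -> has_jet k z).
  { intros z Hz; destruct (Ceq_dec z 0) as [->|Hz0].
    - exact (local_pseries_has_jet _ _ Hck).
    - apply has_jet_dquot; auto. }
  cut (Cmod (c 2%nat) + Cmod (c 1%nat) ^ 2 <= 1); [lra|].
  apply (le_1_of_scaled 0); [lra|]; intros r2 Hr2 _.
  (* The scaling is a square root because what is used in the limit is
     [r^2 (|c2| + |c1|^2) <= r |c2| + r^2 |c1|^2 <= 1]. *)
  pose (r := sqrt r2).
  assert (Hrr : r * r = r2) by (apply sqrt_sqrt; lra).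
  assert (Hr : 0 < r) by (apply sqrt_lt_R0; lra).
  assert (Hr1 : r < 1) by nra.
  assert (Hrabs : Cmod (RtoC r) = r) by (rewrite Cmod_R; apply Rabs_pos_eq; lra).
  pose (a := (RtoC r * c 1%nat)%C).
  assert (Ha : Cmod a <= r).
  { unfold a; rewrite Cmod_mult, Hrabs.
    assert (h' := Cmod_ge_0 (c 1%nat)); nra. }
  pose (D := fun z => (1 + (- Cconj a * RtoC r) * h z)%C).
  assert (HD : forall z, U z -> D z <> RtoC 0).
  { intros z Hz HDz.
    assert (E : (Cconj a * (RtoC r * h z))%C = RtoC 1).
    { replace (RtoC 1) with (1 - D z)%C by (rewrite HDz; ring).
      unfold D; ring. }
    assert (E' := f_equal Cmod E).
    rewrite !Cmod_mult, Cmod_conj, Hrabs, Cmod_1 in E'.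
    specialize (Hh1 z Hz).
    assert (h1 := Cmod_ge_0 a); assert (h2 := Cmod_ge_0 (h z)).
    assert (r * Cmod (h z) <= r) by nra.
    assert (0 <= r * Cmod (h z)) by nra.
    nra. }
  assert (HD_jet : forall z, U z -> has_jet D z).
  { intros z Hz; apply has_jet_plus; [apply has_jet_const|].
    apply has_jet_mult; auto; apply has_jet_const. }
  assert (HG : Cmod (RtoC r * k 0 * / D 0)%C <= 1).
  { apply (schwarz_factor (fun z => RtoC r * k z * / D z)%C); auto.
    - intros z Hz; apply has_jet_mult.
      + apply has_jet_mult; auto; apply has_jet_const.
      + apply has_jet_inv; auto.
    - intros z Hz.
      replace (z * (RtoC r * k z * / D z))%C
        with ((RtoC r * (z * k z)) / D z)%C by (unfold Cdiv; ring).
      unfold k; rewrite dquot_mult, Hh0.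
      rewrite Cmod_div by auto.
      assert (HDz : 0 < Cmod (D z)) by (apply Cmod_gt_0; auto).
      apply Rmult_le_reg_r with (Cmod (D z)); auto.
      unfold Rdiv; rewrite Rmult_assoc, Rinv_l, Rmult_1_r, Rmult_1_l by lra.
      replace (RtoC r * (h z - c 1%nat))%C with (RtoC r * h z - a)%C
        by (unfold a; ring).
      replace (D z) with (1 - Cconj a * (RtoC r * h z))%C by (unfold D; ring).
      apply moebius_le; [lra|].
      rewrite Cmod_mult, Hrabs; specialize (Hh1 z Hz); nra. }
  assert (HD0 : D 0%C = RtoC (1 - r2 * Cmod (c 1%nat) ^ 2)).
  { unfold D; rewrite Hh0.
    replace (- Cconj a * RtoC r * c 1%nat)%C with (- (a * Cconj a))%C
      by (unfold a; ring).
    rewrite <- Cmod2_conj.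
    replace (Cmod a ^ 2) with (r2 * Cmod (c 1%nat) ^ 2)
      by (unfold a; rewrite Cmod_mult, Hrabs, <- Hrr; ring).
    rewrite RtoC_minus, RtoC_mult, <- RtoC_mult; ring. }
  rewrite Cmod_mult, Cmod_inv, Cmod_mult, Hk0, Hrabs in HG by auto.
  rewrite HD0, Cmod_R in HG.
  assert (Hc1' := Cmod_ge_0 (c 1%nat)); assert (Hc2' := Cmod_ge_0 (c 2%nat)).
  assert (Hpos : 0 < 1 - r2 * Cmod (c 1%nat) ^ 2).
  { assert (Cmod (c 1%nat) ^ 2 <= 1) by nra. nra. }
  rewrite Rabs_pos_eq in HG by lra.
  apply Rmult_le_compat_r with (r := 1 - r2 * Cmod (c 1%nat) ^ 2) in HG; [|lra].
  rewrite Rmult_assoc, Rinv_l in HG by lra.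
  assert (r2 <= r) by nra.
  nra.
Qed.

(** * Coefficient relations *)

(** If [F = phi o omega] with [omega = u1 z + u2 z^2 + ...], the coefficients of [F]
    are those of the composite, and [schwarz_pick_coef] constrains [u1] and [u2]. *)
Lemma subordinate_coef (F phi : C -> C) (B : nat -> C) (A0 A1 A2 A3 : C) :
  subordinate F phi -> local_pseries B phi -> jet F A0 A1 A2 A3 ->
  exists u1 u2 : C, Cmod u2 <= 1 - Cmod u1 ^ 2 /\
    A1 = (B 1%nat * u1)%C /\ A2 = (B 1%nat * u2 + B 2%nat * u1 ^ 2)%C.
Proof.
  intros (omega & Han & HU & H0 & HF) Hphi HA.
  destruct (analytic_local_pseries _ Han) as (c & Hc).
  exists (c 1%nat), (c 2%nat).
  split; [now apply (schwarz_pick_coef omega)|].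
  assert (Hj := local_pseries_jet _ _ Hc).
  rewrite <- (local_pseries_0 _ _ Hc), H0 in Hj.
  assert (Hcomp := jet_comp _ _ _ _ _ _ _ _ _ (local_pseries_jet _ _ Hphi) Hj).
  apply jet_ext_near with (G := F) (s := 1) in Hcomp; [|lra|].
  - destruct (jet_unique _ _ _ _ _ _ _ _ _ HA Hcomp) as (_ & H1 & H2 & _); auto.
  - intros z Hz; symmetry; now apply HF.
Qed.

Lemma H_operator_jet (tau : C) (lambda delta : R) (F : C -> C) (a : nat -> C) :
  local_pseries a F -> a 0%nat = 0%C -> exists A0 A3,
  jet (H_operator tau lambda delta F) A0
    (/ tau * (RtoC (1 + lambda + 2 * delta) * a 2%nat))%C
    (/ tau * (RtoC (1 + 2 * lambda + 6 * delta) * a 3%nat))%C A3.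
Proof.
  intros Ha Ha0.
  assert (Hd := local_pseries_derive _ _ Ha).
  assert (Hdd := local_pseries_derive _ _ Hd).
  assert (Hq := local_pseries_dquot _ _ Ha).
  assert (HF0 := local_pseries_0 _ _ Ha); rewrite Ha0 in HF0.
  assert (HdF0 := local_pseries_0 _ _ Hd); cbv beta in HdF0.
  replace (INR 1) with 1 in HdF0 by reflexivity.
  assert (Jd := local_pseries_jet _ _ Hd).
  assert (Jdd := jet_mult _ _ _ _ _ _ _ _ _ _ jet_id (local_pseries_jet _ _ Hdd)).
  assert (Jq := local_pseries_jet _ _ Hq).
  assert (J := jet_plus _ _ _ _ _ _ _ _ _ _ (jet_const 1) (jet_scal (/ tau) _ _ _ _ _
    (jet_plus _ _ _ _ _ _ _ _ _ _ (jet_scal (1 - RtoC lambda) _ _ _ _ _ Jq)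
     (jet_plus _ _ _ _ _ _ _ _ _ _ (jet_scal (RtoC lambda) _ _ _ _ _ Jd)
      (jet_plus _ _ _ _ _ _ _ _ _ _ (jet_scal (RtoC delta) _ _ _ _ _ Jdd)
        (jet_const (-(1)))))))).
  cbv beta in J.
  match type of J with jet _ ?w ?x ?y ?z =>
    exists w, z;
    replace (/ tau * (RtoC (1 + lambda + 2 * delta) * a 2%nat))%C with x;
    [replace (/ tau * (RtoC (1 + 2 * lambda + 6 * delta) * a 3%nat))%C with y|]
  end.
  - revert J; apply jet_ext_near with 1; [lra|].
    intros z _; unfold H_operator.
    replace (quot_id F z) with (dquot F (a 1%nat) z); [ring|].
    unfold dquot, quot_id; destruct (Ceq_dec z 0); [|rewrite HF0; unfold Cdiv; ring].
    rewrite HdF0; ring.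
  - rewrite !S_INR, !RtoC_plus, !RtoC_mult; simpl INR; ring.
  - rewrite !S_INR, !RtoC_plus, !RtoC_mult; simpl INR; ring.
Qed.

(** [g 0 = 0] comes from the injectivity of [f]; the rest is the comparison of
    coefficients in [f (g w) = w]. *)
Lemma inverse_coef (f g : C -> C) (a d : nat -> C) :
  univalent_in_U f -> local_inverse f g ->
  local_pseries a f -> a 0%nat = 0%C -> a 1%nat = 1%C ->
  local_pseries d g ->
  d 0%nat = 0%C /\ d 2%nat = (- a 2%nat)%C /\
  d 3%nat = (2 * a 2%nat ^ 2 - a 3%nat)%C.
Proof.
  intros [_ Hinj] (r & Hr & Hinv) Ha Ha0 Ha1 Hd.
  assert (U0 : U 0%C) by (unfold U; rewrite Cmod_0; lra).
  assert (Hf0 := local_pseries_0 _ _ Ha); rewrite Ha0 in Hf0.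
  assert (Hg0 : g 0%C = 0%C).
  { destruct (Hinv (RtoC 0)) as [h1 h2]; [rewrite Cmod_0; auto|].
    apply Hinj; auto; now rewrite h2, Hf0. }
  assert (Hd0 : d 0%nat = 0%C) by (rewrite <- Hg0; symmetry; now apply local_pseries_0).
  split; auto.
  assert (Ja := local_pseries_jet _ _ Ha); assert (Jd := local_pseries_jet _ _ Hd).
  rewrite Hd0 in Jd; assert (J := jet_comp _ _ _ _ _ _ _ _ _ Ja Jd).
  apply jet_ext_near with (G := fun z => z) (s := r) in J; auto.
  2: intros z Hz; now apply Hinv.
  destruct (jet_unique _ _ _ _ _ _ _ _ _ J jet_id) as (_ & E1 & E2 & E3).
  rewrite Ha1 in E1, E2, E3.
  replace (1 * d 1%nat)%C with (d 1%nat) in E1 by ring.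
  rewrite E1 in E2, E3.
  assert (D2 : d 2%nat = (- a 2%nat)%C).
  { replace (d 2%nat) with ((1 * d 2%nat + a 2%nat * 1 ^ 2) - a 2%nat)%C by ring.
    rewrite E2; ring. }
  split; auto.
  rewrite D2 in E3.
  replace (d 3%nat) with ((1 * d 3%nat + 2 * a 2%nat * 1 * - a 2%nat
    + a 3%nat * 1 ^ 3) + 2 * a 2%nat ^ 2 - a 3%nat)%C by ring.
  rewrite E3; ring.
Qed.

(** * Coefficient estimates *)

(** The right-hand side is at most [b1 (1 - |u1|^2) + |b2| |u1|^2 <= b1]. *)
Lemma coef_bound (tau x u1 u2 : C) (b1 b2 N : R) :
  tau <> RtoC 0 -> 0 < N -> Cmod u2 <= 1 - Cmod u1 ^ 2 -> Rabs b2 <= b1 ->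
  (/ tau * (RtoC N * x))%C = (RtoC b1 * u2 + RtoC b2 * u1 ^ 2)%C ->
  Cmod x <= b1 * Cmod tau / N.
Proof.
  intros Htau HN Hu Hb E.
  assert (HT : 0 < Cmod tau) by now apply Cmod_gt_0.
  assert (E' : (RtoC N * x)%C = (tau * (RtoC b1 * u2 + RtoC b2 * u1 ^ 2))%C)
    by (rewrite <- E; field; auto).
  assert (Hb0 := Rabs_pos b2).
  assert (E2 : N * Cmod x
    = Cmod tau * Cmod (RtoC b1 * u2 + RtoC b2 * u1 ^ 2)%C).
  { rewrite <- Cmod_mult, <- E', Cmod_mult, Cmod_R, Rabs_pos_eq; lra. }
  assert (T := Cmod_triangle (RtoC b1 * u2) (RtoC b2 * u1 ^ 2)).
  rewrite !Cmod_mult, Cmod_pow, !Cmod_R, (Rabs_pos_eq b1) in T by lra.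
  assert (0 <= Cmod u1 ^ 2) by apply pow_le, Cmod_ge_0.
  assert (T' : Cmod (RtoC b1 * u2 + RtoC b2 * u1 ^ 2)%C <= b1) by nra.
  apply Rmult_le_reg_l with N; auto.
  replace (N * (b1 * Cmod tau / N)) with (Cmod tau * b1) by (field; lra).
  rewrite E2; apply Rmult_le_compat_l; lra.
Qed.

(** The first order equations for [f] and [g] force [v1 = - u1]. Adding the second
    order ones eliminates [a3]:
    [2 N a2^2 = tau (b1 (u2 + v2) + 2 b2 u1^2)], whence
    [N |a2|^2 <= |tau| (b1 - (b1 - |b2|) |u1|^2)]. Substituting
    [|u1| = M |a2| / (b1 |tau|)] turns this into the claim. *)
Lemma second_coef_bound (tau a2 a3 u1 u2 v1 v2 : C) (b1 b2 M N : R) :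
  tau <> RtoC 0 -> 0 < M -> 0 < N -> 0 < b1 -> Rabs b2 <= b1 ->
  Cmod u2 <= 1 - Cmod u1 ^ 2 -> Cmod v2 <= 1 - Cmod v1 ^ 2 ->
  (/ tau * (RtoC M * a2))%C = (RtoC b1 * u1)%C ->
  (/ tau * (RtoC N * a3))%C = (RtoC b1 * u2 + RtoC b2 * u1 ^ 2)%C ->
  (/ tau * (RtoC M * - a2))%C = (RtoC b1 * v1)%C ->
  (/ tau * (RtoC N * (2 * a2 ^ 2 - a3)))%C = (RtoC b1 * v2 + RtoC b2 * v1 ^ 2)%C ->
  Cmod a2 <= b1 * sqrt b1 * Cmod tau /
    sqrt (b1 ^ 2 * Cmod tau * N + (b1 - Rabs b2) * M ^ 2).
Proof.
  intros Htau HM HN Hb1 Hb Hu Hv E1 E2 E3 E4.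
  assert (HT : 0 < Cmod tau) by now apply Cmod_gt_0.
  assert (Hb1c : RtoC b1 <> RtoC 0) by (intro h; apply RtoC_inj in h; lra).
  assert (Ev : v1 = (- u1)%C).
  { replace v1 with (/ RtoC b1 * (RtoC b1 * v1))%C by (field; auto).
    replace u1 with (/ RtoC b1 * (RtoC b1 * u1))%C by (field; auto).
    rewrite <- E1, <- E3; ring. }
  subst v1; rewrite Cmod_opp in Hv.
  assert (F1 : M * Cmod a2 = Cmod tau * (b1 * Cmod u1)).
  { assert (h : (RtoC M * a2)%C = (tau * (RtoC b1 * u1))%C)
      by (rewrite <- E1; field; auto).
    apply (f_equal Cmod) in h.
    rewrite !Cmod_mult, !Cmod_R, !Rabs_pos_eq in h; lra. }
  assert (F2 : N * (2 * Cmod a2 ^ 2)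
    = Cmod tau * Cmod (RtoC b1 * (u2 + v2) + RtoC (2 * b2) * u1 ^ 2)%C).
  { assert (h : (RtoC N * (2 * a2 ^ 2))%C
      = (tau * (RtoC b1 * (u2 + v2) + RtoC (2 * b2) * u1 ^ 2))%C).
    { replace (RtoC b1 * (u2 + v2) + RtoC (2 * b2) * u1 ^ 2)%C
        with ((RtoC b1 * u2 + RtoC b2 * u1 ^ 2)
              + (RtoC b1 * v2 + RtoC b2 * (- u1) ^ 2))%C
        by (rewrite RtoC_mult; ring).
      rewrite <- E2, <- E4; field; auto. }
    apply (f_equal Cmod) in h.
    rewrite (Cmod_mult tau) in h.
    rewrite <- h, !Cmod_mult, Cmod_pow, !Cmod_R, !Rabs_pos_eq; lra. }
  assert (T := Cmod_triangle (RtoC b1 * (u2 + v2)) (RtoC (2 * b2) * u1 ^ 2)).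
  assert (T2 := Cmod_triangle u2 v2).
  rewrite !Cmod_mult, Cmod_pow, !Cmod_R, (Rabs_pos_eq b1), Rabs_mult,
    (Rabs_pos_eq 2) in T by lra.
  assert (Hb0 := Rabs_pos b2).
  set (beta := Rabs b2) in *.
  set (P := Cmod u1 ^ 2) in *.
  set (X := Cmod a2 ^ 2) in *.
  assert (G1 : M ^ 2 * X = Cmod tau ^ 2 * (b1 ^ 2 * P)).
  { unfold X, P; replace (M ^ 2 * Cmod a2 ^ 2) with ((M * Cmod a2) ^ 2) by ring.
    rewrite F1; ring. }
  assert (G2 : N * X <= Cmod tau * (b1 - (b1 - beta) * P)).
  { assert (h : Cmod (RtoC b1 * (u2 + v2) + RtoC (2 * b2) * u1 ^ 2)%C
      <= 2 * (b1 - (b1 - beta) * P)).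
    { assert (b1 * Cmod (u2 + v2) <= b1 * (2 * (1 - P)))
        by (apply Rmult_le_compat_l; lra). lra. }
    apply Rmult_le_compat_l with (r := Cmod tau) in h; [|lra]. lra. }
  set (D := b1 ^ 2 * Cmod tau * N + (b1 - beta) * M ^ 2).
  assert (HD : 0 < D).
  { assert (0 < b1 ^ 2 * Cmod tau * N)
      by (apply Rmult_lt_0_compat; auto; apply Rmult_lt_0_compat; auto; now apply pow_lt).
    assert (0 <= (b1 - beta) * M ^ 2) by (apply Rmult_le_pos; [lra|apply pow_le; lra]).
    unfold D; lra. }
  assert (G3 : X * D <= b1 ^ 3 * Cmod tau ^ 2).
  { assert (h : b1 ^ 2 * Cmod tau * (N * X)
      <= b1 ^ 2 * Cmod tau * (Cmod tau * (b1 - (b1 - beta) * P))).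
    { apply Rmult_le_compat_l; auto; apply Rmult_le_pos; [apply pow_le|]; lra. }
    replace (X * D) with (b1 ^ 2 * Cmod tau * (N * X) + (b1 - beta) * (M ^ 2 * X))
      by (unfold D; ring).
    rewrite G1; nra. }
  assert (HsD : 0 < sqrt D) by now apply sqrt_lt_R0.
  apply Rmult_le_reg_r with (sqrt D); auto.
  unfold Rdiv; rewrite Rmult_assoc, Rinv_l, Rmult_1_r by lra.
  assert (Hsb : 0 <= sqrt b1) by apply sqrt_pos.
  apply Rsqr_incr_0_var.
  - unfold Rsqr.
    replace (Cmod a2 * sqrt D * (Cmod a2 * sqrt D))
      with (X * (sqrt D * sqrt D)) by (unfold X; ring).
    replace (b1 * sqrt b1 * Cmod tau * (b1 * sqrt b1 * Cmod tau))
      with (b1 ^ 2 * (sqrt b1 * sqrt b1) * Cmod tau ^ 2) by ring.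
    rewrite !sqrt_sqrt by lra.
    replace (b1 ^ 2 * b1 * Cmod tau ^ 2) with (b1 ^ 3 * Cmod tau ^ 2) by ring.
    exact G3.
  - repeat apply Rmult_le_pos; lra.
Qed.

Theorem theorem2p8 (tau : C) (lambda delta : R) (phi : C -> C) (B : nat -> R)
    (f : C -> C) (a : nat -> C)
    (htau : tau <> RtoC 0) (hlambda : 1 <= lambda)
    (hdelta : 0 <= delta <= 1)
    (hphi : admissible_phi phi B)
    (hf : H_Sigma tau lambda delta phi f)
    (ha : normalized_expansion f a)
    (hB : Rabs (B 2%nat) <= B 1%nat) :
  ((B 2%nat < 0 -> 0 <= B 1%nat + B 2%nat ->
      Cmod (a 2%nat) <=
        B 1%nat * sqrt (B 1%nat) * Cmod tau /
        sqrt (B 1%nat ^ 2 * Cmod tau * (1 + 2 * lambda + 6 * delta)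
              + (B 1%nat + B 2%nat) * (1 + lambda + 2 * delta) ^ 2))
   /\
   (0 < B 2%nat -> 0 <= B 1%nat - B 2%nat ->
      Cmod (a 2%nat) <=
        B 1%nat * sqrt (B 1%nat) * Cmod tau /
        sqrt (B 1%nat ^ 2 * Cmod tau * (1 + 2 * lambda + 6 * delta)
              + (B 1%nat - B 2%nat) * (1 + lambda + 2 * delta) ^ 2)))
  /\
  ((Rabs (B 2%nat) < B 1%nat ->
      Cmod (a 3%nat) <= B 1%nat * Cmod tau / (1 + 2 * lambda + 6 * delta))
   /\
   (B 1%nat < Rabs (B 2%nat) ->
      Cmod (a 3%nat) <=
        Cmod (RtoC (B 2%nat) * tau)%C / (1 + 2 * lambda + 6 * delta)))
  /\
  ((Rabs (B 2%nat) < B 1%nat ->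
      Cmod (a 3%nat - RtoC 2 * (a 2%nat) ^ 2)%C
        <= B 1%nat * Cmod tau / (1 + 2 * lambda + 6 * delta))
   /\
   (B 1%nat < Rabs (B 2%nat) ->
      Cmod (a 3%nat - RtoC 2 * (a 2%nat) ^ 2)%C
        <= Cmod (RtoC (B 2%nat) * tau)%C / (1 + 2 * lambda + 6 * delta))).

Proof.
  destruct hf as (g & (Huf & _ & Hug & Hloc) & Hsf & Hsg).
  destruct ha as (Ha0 & Ha1 & Haf).
  destruct hphi as [_ _ _ _ _ _ HB1 HBphi].
  assert (Hphi : local_pseries (fun n => RtoC (B n)) phi)
    by (exists 1; split; [lra|exact HBphi]).
  assert (Hfa : local_pseries a f) by (exists 1; split; [lra|exact Haf]).
  destruct (analytic_local_pseries g (proj1 Hug)) as (d & Hgd).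
  destruct (inverse_coef f g a d Huf Hloc Hfa Ha0 Ha1 Hgd) as (Hd0 & Hd2 & Hd3).
  destruct (H_operator_jet tau lambda delta f a Hfa Ha0) as (A0 & A3 & Jf).
  destruct (H_operator_jet tau lambda delta g d Hgd Hd0) as (D0 & D3 & Jg).
  destruct (subordinate_coef _ _ _ _ _ _ _ Hsf Hphi Jf)
    as (u1 & u2 & Hu & E1 & E2).
  destruct (subordinate_coef _ _ _ _ _ _ _ Hsg Hphi Jg)
    as (v1 & v2 & Hv & E3 & E4).
  rewrite Hd2 in E3; rewrite Hd3 in E4.
  assert (HM : 0 < 1 + lambda + 2 * delta) by lra.
  assert (HN : 0 < 1 + 2 * lambda + 6 * delta) by lra.
  assert (K2 := second_coef_bound _ _ _ _ _ _ _ _ _ _ _ htau HM HN HB1 hB Hu Hv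
    E1 E2 E3 E4).
  assert (K3 := coef_bound _ _ _ _ _ _ _ htau HN Hu hB E2).
  assert (K4 := coef_bound _ _ _ _ _ _ _ htau HN Hv hB E4).
  replace (2 * a 2%nat ^ 2 - a 3%nat)%C
    with (- (a 3%nat - RtoC 2 * a 2%nat ^ 2))%C in K4 by ring.
  rewrite Cmod_opp in K4.
  (* Since |B2| <= B1, the branches with B1 < |B2| are void. *)
  repeat split; try (intros; exact K3); try (intros; exact K4); try (intros; lra).
  - intros Hneg _; rewrite Rabs_left in K2 by exact Hneg.
    replace (B 1%nat - - B 2%nat) with (B 1%nat + B 2%nat) in K2 by ring.
    exact K2.
  - intros Hpos _; rewrite Rabs_pos_eq in K2 by lra; exact K2.
Qed.
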